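(* Let $k\in\mathbb{N}$, $\nu\ge0$, $\alpha>-1$, and let $(Q_n)_{n\in\mathbb{N}_0}$ be a sequence of real polynomials. The orthogonality $$\int_0^\infty Q_n(x)Q_m(x)\rho_{\nu,k}(x)x^\alpha\,dx=\delta_{m,n},\qquad m,n\in\mathbb{N}_0,$$ is equivalent to the composition orthogonality with respect to the weight $\rho_{\nu,k-1}$: $$\int_0^\infty\rho_{\nu,k-1}(t)\,Q_n(\theta)Q_m(\theta)\{t^\alpha\}\,dt=\frac{\delta_{m,n}}{\Gamma(1+\alpha)},\qquad m,n\in\mathbb{N}_0.$$ In particular, for $k=2$ the sequence is compositionally orthogonal with respect to the weight $\rho_{\nu,1}(t)=2t^{\nu/2}K_\nu(2\sqrt t)$ (in the sense of Prudnikov).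
   Context: For $x>0$, $\nu\ge0$, $k\in\mathbb{N}_0$, the ultra-exponential weight function is $$\rho_{\nu,k}(x)=\frac{1}{2\pi i}\int_{\gamma-i\infty}^{\gamma+i\infty}\Gamma(\nu+s)[\Gamma(s)]^kx^{-s}\,ds,\qquad\gamma>0;$$ thus $\rho_{\nu,0}(x)=x^\nu e^{-x}$ and $\rho_{\nu,1}(x)=2x^{\nu/2}K_\nu(2\sqrt x)$, with $K_\nu$ the modified Bessel function of the second kind. The operator $\theta=tDt$ acts by $(\theta f)(t)=t\frac{d}{dt}(tf(t))$; for a polynomial $Q(x)=\sum_jq_jx^j$, $Q(\theta)=\sum_jq_j\theta^j$, and $Q_n(\theta)Q_m(\theta)$ is the composition of operators; note $\theta^j\{t^\alpha\}=(1+\alpha)_jt^{\alpha+j}$. *)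

(* Defs.v *)
From mathcomp Require Import all_boot all_order all_algebra.
From mathcomp Require Import all_classical all_reals all_analysis.
Set Implicit Arguments. Unset Strict Implicit. Unset Printing Implicit Defensive.
Import Order.TTheory GRing.Theory Num.Theory.
Import numFieldNormedType.Exports.
Local Open Scope classical_set_scope.
Local Open Scope ring_scope.

Section Defs.
Variable R : realType.

(* Complex numbers are represented as pairs (real part, imaginary part). *)
Definition cmul (z w : R * R) : R * R :=
  (z.1 * w.1 - z.2 * w.2, z.1 * w.2 + z.2 * w.1).

(* Euler's Gamma function Γ(a + i b) = ∫_0^∞ t^(a+ib-1) e^(-t) dt, for a > 0,
   with t^(ib) = cos(b ln t) + i sin(b ln t). *)
Definition GammaC (s : R * R) : R * R :=
  (Rintegral lebesgue_measure `]0%R, +oo[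
     (fun t => t `^ (s.1 - 1) * cos (s.2 * ln t) * expR (- t)),
   Rintegral lebesgue_measure `]0%R, +oo[
     (fun t => t `^ (s.1 - 1) * sin (s.2 * ln t) * expR (- t))).

Definition GammaR (a : R) : R := (GammaC (a, 0)).1.

Definition cpow_neg (x : R) (s : R * R) : R * R :=
  (x `^ (- s.1) * cos (s.2 * ln x), - (x `^ (- s.1) * sin (s.2 * ln x))).

(* Integrand of the Mellin-Barnes integral on the line s = γ + i y, γ = 1:
   Γ(ν+s) Γ(s)^k x^(-s). *)
Definition rho_integrand (nu : R) (k : nat) (x : R) (y : R) : R * R :=
  let s := (1, y) in
  cmul (cmul (GammaC (nu + s.1, s.2)) (iter k (cmul (GammaC s)) (1, 0)))
       (cpow_neg x s).

(* ρ_{ν,k}(x) = (1/(2πi)) ∫_{γ-i∞}^{γ+i∞} Γ(ν+s) Γ(s)^k x^(-s) ds with γ = 1;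
   parametrizing s = γ + i y gives ds = i dy, so this is
   (1/(2π)) ∫_R Γ(ν+γ+iy) Γ(γ+iy)^k x^(-γ-iy) dy, a real number
   (we take the real part; the imaginary part integrates to 0). *)
Definition rho (nu : R) (k : nat) (x : R) : R :=
  (2 * pi)^-1 * Rintegral lebesgue_measure setT
                  (fun y => (rho_integrand nu k x y).1).

Definition theta (f : R -> R) : R -> R :=
  fun t => t * derive1 (fun u => u * f u) t.

Definition polyop (Q : {poly R}) (f : R -> R) : R -> R :=
  fun t => \sum_(j < size Q) Q`_j * iter j theta f t.

End Defs.

(* Main.v *)
Require Import Defs.
From mathcomp Require Import all_boot all_order all_algebra.
From mathcomp Require Import all_classical all_reals all_analysis.
From mathcomp Require Import measurable_realfun.
From mathcomp Require Import ring lra.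
Set Implicit Arguments. Unset Strict Implicit. Unset Printing Implicit Defensive.
Import Order.TTheory GRing.Theory Num.Theory.
Import numFieldNormedType.Exports.
Local Open Scope classical_set_scope.
Local Open Scope ring_scope.

(** Let [M] be the Mellin transform on the positive half line.  On the line [Re s = 1],
    [rho nu k.+1] is the inverse Mellin transform of [Gamma s] times that of
    [rho nu k]; inserting Euler's integral for [Gamma s] and exchanging integrals
    gives [rho nu k.+1 x = int exp (- t) rho nu k (x / t) dt / t].  Mellin inversion
    is needed only for [k = 0], where it says [rho nu 0 x = x ^ nu exp (- x)]; hence
    every [rho nu k] is nonnegative, and by Tonelli
    [M (rho nu k.+1) a = Gamma a * M (rho nu k) a] for all [a > 0].
    As [Gamma (1 + alpha + i) = (1 + alpha)_i Gamma (1 + alpha)] and [theta] raises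
    [t ^ (alpha + i)] to [(1 + alpha + i) t ^ (alpha + i + 1)], integrating [x ^ alpha p(x)]
    against [rho nu k.+1] is [Gamma (1 + alpha)] times integrating [p(theta) t ^ alpha]
    against [rho nu k], with [p = Q_n Q_m]. *)

(** * Integration of derivatives on the positive half line *)

(** The bound on [rho nu k x] that its definition yields on the line [Re s = 1] is [B / x], and no
    factor [x ^ (a - 1)] makes that integrable on the half line. The moments are therefore out of
    reach of absolute Fubini; nonnegativity is what gives access to Tonelli. It is secured by a
    recursion with values in [\bar R], nonnegative by construction, which is identified with [rho]
    afterwards. The recursion has to start from a true inversion formula. There an Abel factor
    [exp (- e y)] turns the integral over the vertical line into a Poisson kernel in the variable
    [ln t], and [e] tends to [0]. The remaining vertical integrals converge absolutely once Gamma
    decays quadratically, which its functional equation already provides. On the algebraic side,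
    functions [t ^ a p(t)] with [p] a polynomial are stable under theta, and composition of
    operators becomes multiplication of polynomials. For each pair of indices the two integrals then
    differ by the same nonzero factor [GammaR (1 + alpha)], so the equivalence is an entrywise
    division. *)

Section HalfLine.
Context {R : realType}.
Notation mu := (@lebesgue_measure R).
Notation D := (`]0%R, +oo[%classic : set R).

Lemma continuous_pos_measurable (f : R -> R) :
  (forall x : R, 0 < x -> {for x, continuous f}) -> measurable_fun D f.
Proof.
move=> cf; apply: open_continuous_measurable_fun => //.
by move=> x; rewrite inE/= in_itv/= andbT => /cf.
Qed.

Lemma integral_segment_deriv (F f : R -> R) (a b : R) : 0 < a -> a < b ->
  (forall x : R, 0 < x -> {for x, continuous f}) ->
  (forall x : R, 0 < x -> is_derive x 1 F (f x)) ->
  (\int[mu]_(x in `[a, b]) (f x)%:E = (F b)%:E - (F a)%:E)%E.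
Proof.
move=> a0 ab cf dF; apply: continuous_FTC2 => //.
- apply: continuous_in_subspaceT => x; rewrite inE/= in_itv/= => /andP[ax _].
  exact/cf/(lt_le_trans a0).
- have cF (x : R) : 0 < x -> {for x, continuous F}.
    move=> x0; apply: differentiable_continuous.
    by apply/derivable1_diffP; have [] := dF _ x0.
  split.
  + move=> x; rewrite in_itv/= => /andP[ax _].
    by have [] := dF _ (lt_trans a0 ax).
  + exact/cvg_at_right_filter/cF.
  + exact/cvg_at_left_filter/cF/(lt_trans a0).
- move=> x; rewrite in_itv/= => /andP[ax _].
  by rewrite derive1E; have [_] := dF _ (lt_trans a0 ax).
Qed.

(** The upper end [n + 2] instead of [n + 1] keeps the interval nondegenerate at [n = 0]. *)
Let seg (n : nat) : set R := `[n.+1%:R^-1, n.+2%:R]%classic.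

Let nd_seg m n : (m <= n)%N -> seg m `<=` seg n.
Proof.
move=> mn x; rewrite /seg/= !in_itv/= => /andP[mx xm]; apply/andP; split.
  by rewrite (le_trans _ mx)// lef_pV2 ?posrE// ler_nat ltnS.
by rewrite (le_trans xm)// ler_nat !ltnS.
Qed.

Let bigcup_seg : \bigcup_n seg n = D.
Proof.
apply/seteqP; split=> [x [n _]|x]; rewrite /seg/= !in_itv/= ?andbT.
  by move=> /andP[+ _]; apply: lt_le_trans; rewrite invr_gt0.
move=> x0; pose n := (Num.truncn x + Num.truncn x^-1)%N.
have xV0 : 0 < x^-1 by rewrite invr_gt0.
exists n => //=; rewrite in_itv/=; apply/andP; split.
  rewrite -[leRHS]invrK lef_pV2 ?posrE//.
  rewrite (le_trans (ltW (archimedean.Num.Theory.truncnS_gt _)))//.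
  by rewrite ler_nat ltnS leq_addl.
rewrite (le_trans (ltW (archimedean.Num.Theory.truncnS_gt _)))//.
by rewrite ler_nat ltnS leqW// leq_addr.
Qed.

Let near_seg (x : R) : 0 < x -> \forall n \near \oo, seg n x.
Proof.
rewrite -(_ : D x <-> 0 < x); last by rewrite /= in_itv/= andbT.
rewrite -bigcup_seg => -[n _ nx]; exists n => // m /= nm.
exact: nd_seg nm _ nx.
Qed.

Let seg_gt0 n x : seg n x -> 0 < x.
Proof.
move=> nx; have : (\bigcup_n seg n) x by exists n.
by rewrite bigcup_seg /= in_itv/= andbT.
Qed.

Let seg_sub n : seg n `<=` D.
Proof. by move=> x /seg_gt0; rewrite /= in_itv/= andbT. Qed.

Let seg_cvg (F f : R -> R) (l0 ly : R) :
  (forall x : R, 0 < x -> {for x, continuous f}) ->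
  (forall x : R, 0 < x -> is_derive x 1 F (f x)) ->
  F x @[x --> 0^'+] --> l0 -> F x @[x --> +oo] --> ly ->
  (\int[mu]_(x in seg n) (f x)%:E)%E @[n --> \oo] --> (ly - l0)%:E.
Proof.
move=> cf dF F0 Fy.
have segE n : (\int[mu]_(x in seg n) (f x)%:E)%E = (F n.+2%:R - F n.+1%:R^-1)%:E.
  rewrite EFinB; apply: integral_segment_deriv => //.
    by rewrite (@le_lt_trans _ _ 1)// ?invf_le1// ?ler1n// ltr1n.
under eq_fun do rewrite segE.
apply: cvg_EFin; first exact: nearW.
apply: cvgB.
  apply: (cvg_comp (fun n : nat => n.+2%:R : R) F); last exact: Fy.
  by have := @cvgr_idn R; rewrite -(cvg_shiftn 2); under eq_fun do rewrite addn2.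
move/cvg_at_rightP : F0; apply; split => //; last exact: cvg_harmonic.
Qed.

(** Monotone convergence along the segments. Integrability is not assumed, so this version can
    establish it. *)
Lemma ge0_integral0y_deriv (F f : R -> R) (l0 ly : R) :
  (forall x : R, 0 < x -> 0 <= f x) ->
  (forall x : R, 0 < x -> {for x, continuous f}) ->
  (forall x : R, 0 < x -> is_derive x 1 F (f x)) ->
  F x @[x --> 0^'+] --> l0 -> F x @[x --> +oo] --> ly ->
  (\int[mu]_(x in D) (f x)%:E = (ly - l0)%:E)%E.
Proof.
move=> f0 cf dF F0 Fy.
have mf n : measurable_fun (seg n) (EFin \o f).
  apply/measurable_EFinP.
  apply: (measurable_funS (E := D)) (continuous_pos_measurable cf) => //.
rewrite -[in LHS]bigcup_seg; apply/esym/(cvg_unique _ (seg_cvg cf dF F0 Fy)) => //.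
apply: ge0_nondecreasing_set_cvg_integral => //.
- by move=> m n mn; rewrite subsetEset; exact: nd_seg.
- by move=> n; exact: measurable_itv.
- by move=> n x /seg_gt0/f0; rewrite lee_fin.
Qed.

(** The version for oscillating integrands: dominated convergence along the segments, with [|f|] as
    the dominating function. *)
Lemma integral0y_deriv (F f : R -> R) (l0 ly : R) :
  mu.-integrable D (EFin \o f) ->
  (forall x : R, 0 < x -> {for x, continuous f}) ->
  (forall x : R, 0 < x -> is_derive x 1 F (f x)) ->
  F x @[x --> 0^'+] --> l0 -> F x @[x --> +oo] --> ly ->
  (\int[mu]_(x in D) (f x)%:E = (ly - l0)%:E)%E.
Proof.
move=> intf cf dF F0 Fy.
have mf := continuous_pos_measurable cf.
have [//||||||_ _ /=] := @dominated_convergence _ _ _ mu D _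
  (fun n => (EFin \o f) \_ (seg n)) (EFin \o f) (abse \o (EFin \o f)).
- move=> n; apply: measurable_funTS.
  apply/(measurable_restrictT _ (measurable_itv _)); apply/measurable_EFinP.
  apply: (measurable_funS (E := D)) => //.
  exact: (@seg_sub n).
- exact/measurable_EFinP.
- apply: aeW => x; rewrite /= in_itv/= andbT => x0.
  apply: cvg_near_cst; near=> n; rewrite patchT// inE.
  by near: n; exact: near_seg.
- exact: integrable_abse.
- apply: aeW => x n _; rewrite /patch; case: ifPn => //= _.
  by rewrite normr0 lee_fin.
under eq_fun => n.
  rewrite -integral_mkcondr setIC (_ : seg n `&` D = seg n); last first.
    by apply/setIidPl; exact: seg_sub.
  over.
move=> h; apply: (cvg_unique _ h (seg_cvg cf dF F0 Fy)) => //.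
Unshelve. all: by end_near. Qed.
End HalfLine.

(** * Elementary derivatives and the limits of [x ^ a exp (- x)] *)

Section Calculus.
Context {R : realType}.
Notation mu := (@lebesgue_measure R).
Notation D := (`]0%R, +oo[%classic : set R).

Lemma is_deriveM_fun (f g : R -> R) (x df dg : R) :
  is_derive x 1 f df -> is_derive x 1 g dg ->
  is_derive x 1 (fun t => f t * g t) (df * g x + f x * dg).
Proof.
move=> hf hg; apply: is_derive_eq (is_deriveM hf hg) _.
by rewrite /GRing.scale/= addrC mulrC [f x * _]mulrC mulrC [dg * _]mulrC.
Qed.

Lemma is_derive_comp_fun (f g : R -> R) (x df dg : R) :
  is_derive (g x) 1 f df -> is_derive x 1 g dg ->
  is_derive x 1 (fun t => f (g t)) (df * dg).
Proof. by move=> hf hg; exact: is_derive1_comp. Qed.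

Lemma is_derive_continuous (f : R -> R) (x df : R) :
  is_derive x 1 f df -> {for x, continuous f}.
Proof.
by move=> [df' _]; apply: differentiable_continuous; apply/derivable1_diffP.
Qed.

(** Raise [x / c <= 1 + x / c <= exp (x / c)] to the power [c]. *)
Lemma powR_le_expR (c x : R) : 0 < c -> 0 <= x -> x `^ c <= c `^ c * expR x.
Proof.
move=> c0 x0; have -> : x = c * (x / c) by rewrite mulrC divfK// gt_eqF.
have xc0 : 0 <= x / c by rewrite divr_ge0// ltW.
rewrite powRM ?(ltW c0)// ler_pM2l ?powR_gt0//.
rewrite [c * _]mulrC expRM ge0_ler_powR ?nnegrE ?expR_ge0 ?(ltW c0)//.
by rewrite (le_trans _ (expR_ge1Dx _))// lerDr.
Qed.

Lemma powR_expRN_le (c x : R) : 0 < c -> 0 <= x -> x `^ c * expR (- x) <= c `^ c.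
Proof. by move=> c0 x0; rewrite expRN ler_pdivrMr ?expR_gt0// powR_le_expR. Qed.

Lemma cvgy_powR_expRN (a : R) : 0 < a -> x `^ a * expR (- x) @[x --> +oo] --> (0 : R).
Proof.
(* Bounding [x ^ (a + 1) exp (- x)] by the constant [K] leaves a spare factor [1 / x] for
   [x ^ a exp (- x)]. *)
move=> a0; pose K := (a + 1) `^ (a + 1).
apply: (@squeeze_cvgr _ _ _ _ (cst 0) (fun x => K * x^-1)).
- near=> x; have x0 : 0 < x by near: x; exact: nbhs_pinfty_gt.
  rewrite mulr_ge0 ?powR_ge0 ?expR_ge0//= ler_pdivlMr//.
  have -> : x `^ a * expR (- x) * x = x `^ (a + 1) * expR (- x).
    by rewrite powRD ?powRr1 ?ltW// ?(gt_eqF x0)// ?implybT//; ring.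
  by apply: powR_expRN_le; rewrite ?ltW// addr_gt0.
- exact: cvg_cst.
- rewrite -[X in _ --> X](mulr0 K); apply: cvgMr; apply/gtr0_cvgV0.
    by near=> x; near: x; exact: nbhs_pinfty_gt.
  exact: cvg_id.
Unshelve. all: by end_near. Qed.

Lemma cvg0_powR_expRN (a : R) : 0 < a -> x `^ a * expR (- x) @[x --> 0^'+] --> (0 : R).
Proof.
move=> a0; apply: (@squeeze_cvgr _ _ _ _ (cst 0) (fun x => x `^ a)).
- near=> x; rewrite mulr_ge0 ?powR_ge0 ?expR_ge0//= ler_piMr ?powR_ge0//.
  by rewrite -expR0 ler_expR oppr_le0.
- exact: cvg_cst.
- exact: powR_cvg0.
Unshelve. all: by end_near. Qed.

Lemma is_derive_powR (a x : R) : 0 < x -> is_derive x 1 (fun t : R => t `^ a) (a * x `^ (a - 1)).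
Proof. by move=> x0; exact: is_derive1_powR. Qed.

Lemma is_derive_expRN (x : R) : is_derive x 1 (fun t : R => expR (- t)) (- expR (- x)).
Proof.
rewrite -mulrN1; apply: (is_derive_comp_fun (f := expR) (g := -%R)).
Qed.

Lemma is_derive_phase (c : R -> R) (dc y x : R) : 0 < x ->
  is_derive (y * ln x) 1 c dc -> is_derive x 1 (fun t => c (y * ln t)) (dc * (y / x)).
Proof.
move=> x0 hc; apply: (is_derive_comp_fun (f := c) (g := fun t => y * ln t)) => //.
apply: is_derive_eq; first exact: (is_deriveZ y (is_derive1_ln x0)).
by [].
Qed.

End Calculus.

(** * Euler's integral *)

Section GammaIntegrability.
Context {R : realType}.
Notation mu := (@lebesgue_measure R).
Notation D := (`]0%R, +oo[%classic : set R).

(* The derivative of [(t / (1 + t)) ^ a]; it dominates [t ^ (a - 1) exp (- t)] up to a constant. *)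
Let gauge (a t : R) : R := a * (t / (1 + t)) `^ (a - 1) * (1 + t) ^- 2.

Let is_derive_ratio (a x : R) : 0 < x ->
  is_derive x 1 (fun t => (t / (1 + t)) `^ a) (gauge a x).
Proof.
move=> x0; have x10 : 1 + x != 0 by rewrite gt_eqF// addr_gt0.
have q0 : 0 < x / (1 + x) by rewrite divr_gt0// addr_gt0.
have dD : is_derive x 1 (fun t : R => 1 + t) 1.
  by rewrite -[X in is_derive _ _ _ X]add0r; exact: (is_deriveD (is_derive_cst (1 : R) x 1)
    (is_derive_id x 1)).
have dq : is_derive x 1 (fun t => t / (1 + t)) ((1 + x) ^- 2).
  have dV : is_derive x 1 (fun t : R => (1 + t)^-1) (- (1 + x) ^- 2 *: 1).
    exact: (is_deriveV x10 dD).
  apply: is_derive_eq (is_deriveM_fun (is_derive_id x 1) dV) _.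
  rewrite /GRing.scale/= mul1r mulr1.
  by field.
exact: (is_derive_comp_fun (g := fun t : R => t / (1 + t)) (is_derive_powR a q0) dq).
Qed.

Let continuous_gauge (a x : R) : 0 < x -> {for x, continuous (gauge a)}.
Proof.
move=> x0; have x10 : 1 + x != 0 by rewrite gt_eqF// addr_gt0.
have cD : {for x, continuous (fun t : R => 1 + t)}.
  by apply: cvgD; [exact: cvg_cst|exact: cvg_id].
apply: cvgM.
  apply: cvgM; first exact: cvg_cst.
  exact: (is_derive_continuous (is_derive_ratio (a - 1) x0)).
apply: cvgV; first by rewrite expf_neq0.
by apply: (@cvg_comp _ _ _ (fun t : R => 1 + t) (fun u => u ^+ 2) _ _ _ cD);
  exact: exprn_continuous.
Qed.

Let integrable_gauge (a : R) : 0 < a -> mu.-integrable D (EFin \o gauge a).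
Proof.
move=> a0; have g0 (x : R) : 0 < x -> 0 <= gauge a x.
  move=> x0; rewrite mulr_ge0// ?mulr_ge0 ?powR_ge0 ?(ltW a0)//.
  by rewrite invr_ge0 exprn_ge0// addr_ge0// ltW.
apply/integrableP; split.
  apply/measurable_EFinP; apply: continuous_pos_measurable; exact: continuous_gauge.
under eq_integral => x.
  rewrite inE/= in_itv/= andbT => x0; rewrite ger0_norm ?g0//; over.
rewrite (ge0_integral0y_deriv (l0 := 0) (ly := 1) g0 (@continuous_gauge a) (@is_derive_ratio
  a)) ?ltry//.
- apply: (@squeeze_cvgr _ _ _ _ (cst 0) (fun t => t `^ a)).
  + near=> x; rewrite powR_ge0/= ge0_ler_powR ?nnegrE ?(ltW a0)//.
      by rewrite divr_ge0// ?addr_ge0.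
    by rewrite ler_pdivrMr ?ltr_pwDl// ler_peMr// lerDl.
  + exact: cvg_cst.
  + exact: powR_cvg0.
- have e1 : (1 : R) `^ a = 1 by rewrite powR1.
  rewrite -[X in _ --> X]e1.
  apply: (@cvg_comp _ _ _ (fun t : R => t / (1 + t)) (fun t => t `^ a) _ (nbhs (1 : R)));
    last first.
    exact: (is_derive_continuous (is_derive_powR a ltr01)).
  have h : (1 - (1 + t)^-1 : R) @[t --> +oo] --> (1 : R).
    rewrite -[X in _ --> X]subr0; apply: cvgB; first exact: cvg_cst.
    apply/gtr0_cvgV0.
      near=> t; have t0 : 0 < t by near: t; exact: nbhs_pinfty_gt.
      by rewrite addr_gt0.
    apply/cvgryPge => A; near=> t; rewrite -lerBlDl.
    by near: t; apply: nbhs_pinfty_ge; rewrite num_real.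
  apply: cvg_trans h; apply: near_eq_cvg; near=> t.
  have t0 : 0 < t by near: t; exact: nbhs_pinfty_gt.
  have t10 : 1 + t != 0 by rewrite gt_eqF// addr_gt0.
  by field.
Unshelve. all: by end_near. Qed.

Lemma continuous_gamma_integrand (a y : R) (c dc : R -> R) (x : R) :
  (forall u : R, is_derive u 1 c (dc u)) -> 0 < x ->
  {for x, continuous (fun t => t `^ a * c (y * ln t) * expR (- t))}.
Proof.
move=> hc x0; apply: is_derive_continuous.
apply: (is_deriveM_fun _ (is_derive_expRN x)).
exact: (is_deriveM_fun (is_derive_powR a x0) (is_derive_phase x0 (hc _))).
Qed.

(** A generic phase [c] bounded by [1] treats the real part ([cos]), the imaginary part ([sin]) and
    their derivatives at once. *)
Lemma integrable_gamma (a y : R) (c dc : R -> R) : 0 < a ->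
  (forall u : R, is_derive u 1 c (dc u)) -> (forall u : R, `|c u| <= 1) ->
  mu.-integrable D (EFin \o (fun t => t `^ (a - 1) * c (y * ln t) * expR (- t))).
Proof.
(* Write [t ^ (a - 1)] as [(t / (1 + t)) ^ (a - 1) (1 + t) ^ (a + 1) (1 + t) ^ -2]. The bound [(1 +
   t) ^ (a + 1) exp (- (1 + t)) <= (a + 1) ^ (a + 1)] gives the first two factors of [K]; division
   by [a] cancels the leading [a] of [gauge]. *)
move=> a0 hc c1; pose K := (a + 1) `^ (a + 1) * expR 1 / a.
apply: (le_integrable _ _ _ (integrableZl _ K (integrable_gauge a0))) => //.
  apply/measurable_EFinP; apply: continuous_pos_measurable => x x0.
  exact: continuous_gamma_integrand.
move=> t; rewrite /= in_itv/= andbT => t0; rewrite lee_fin.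
have t10 : 0 < 1 + t by rewrite addr_gt0.
rewrite !normrM (ger0_norm (powR_ge0 _ _)) (ger0_norm (expR_ge0 _)).
rewrite (@le_trans _ _ (t `^ (a - 1) * expR (- t)))//.
  by rewrite -mulrA ler_wpM2l ?powR_ge0// ler_piMl ?expR_ge0.
rewrite !ger0_norm ?mulr_ge0 ?invr_ge0 ?powR_ge0 ?expR_ge0 ?exprn_ge0 ?(ltW a0) ?(ltW t10)//.
have h : (1 + t) `^ (a + 1) * expR (- t) <= (a + 1) `^ (a + 1) * expR 1.
  have := @powR_expRN_le _ (a + 1) (1 + t) (addr_gt0 a0 ltr01) (ltW t10).
  by rewrite opprD expRD [expR (- 1)]expRN mulrCA ler_pdivrMl ?expR_gt0// mulrC [leRHS]mulrC.
have -> : K * gauge a t = (a + 1) `^ (a + 1) * expR 1 *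
    ((t / (1 + t)) `^ (a - 1) * (1 + t) ^- 2).
  rewrite /K /gauge; field; rewrite ?gt_eqF//.
apply: (@le_trans _ _ ((1 + t) `^ (a + 1) * expR (- t) *
    ((t / (1 + t)) `^ (a - 1) * (1 + t) ^- 2))); last first.
  by rewrite ler_wpM2r// ?mulr_ge0 ?powR_ge0// invr_ge0 exprn_ge0// ltW.
rewrite le_eqVlt; apply/orP; left; apply/eqP.
have -> : (1 + t) `^ (a + 1) = (1 + t) `^ (a - 1) * (1 + t) ^+ 2.
  rewrite -powR_mulrn ?(ltW t10)// -powRD; last by rewrite (gt_eqF t10) implybT.
  by congr (_ `^ _); ring.
have -> : t `^ (a - 1) = (t / (1 + t)) `^ (a - 1) * (1 + t) `^ (a - 1).
  by rewrite -powRM ?divfK ?gt_eqF// ?divr_ge0// ltW.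
by field; rewrite gt_eqF.
Qed.

End GammaIntegrability.

(** * Recurrence, positivity and decay of Gamma on vertical lines *)

Section GammaDecay.
Context {R : realType}.
Notation mu := (@lebesgue_measure R).
Notation D := (`]0%R, +oo[%classic : set R).

Definition oscillating_gamma (c : R -> R) (a y : R) : R :=
  Rintegral mu D (fun t => t `^ (a - 1) * c (y * ln t) * expR (- t)).

Notation W := oscillating_gamma.

Lemma is_derive_Nsin (u : R) : is_derive u 1 (fun x : R => - sin x) (- cos u).
Proof. exact: is_deriveN. Qed.

Lemma oscillating_gammaN (c dc : R -> R) (a y : R) : 0 < a ->
  (forall u : R, is_derive u 1 c (dc u)) -> (forall u : R, `|c u| <= 1) ->
  W (fun u => - c u) a y = - W c a y.
Proof.
move=> a0 hc c1; rewrite /oscillating_gamma -[RHS]mulN1r -RintegralZl//.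
  by apply: eq_Rintegral => t _; ring.
exact: integrable_gamma hc c1.
Qed.

(** Integration by parts: [t ^ a c(y ln t) exp (- t)] vanishes at both ends, so its derivative has
    integral zero. The chain rule on [c(y ln t)] produces the term in [dc]. For [cos] and [sin]
    together this is [Gamma (s + 1) = s Gamma s]. *)
Lemma oscillating_gammaS (c dc ddc : R -> R) (a y : R) : 0 < a ->
  (forall u : R, is_derive u 1 c (dc u)) ->
  (forall u : R, is_derive u 1 dc (ddc u)) ->
  (forall u : R, `|c u| <= 1) -> (forall u : R, `|dc u| <= 1) ->
  W c (a + 1) y = a * W c a y + y * W dc a y.
Proof.
move=> a0 hc hdc c1 dc1.
pose h (c : R -> R) b t := t `^ (b - 1) * c (y * ln t) * expR (- t).
have ic : mu.-integrable D (EFin \o h c a) by exact: integrable_gamma hc c1.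
have idc : mu.-integrable D (EFin \o h dc a) by exact: integrable_gamma hdc dc1.
have icS : mu.-integrable D (EFin \o h c (a + 1)).
  by apply: integrable_gamma hc c1; rewrite addr_gt0.
have iac : mu.-integrable D (EFin \o (fun t => a * h c a t)) by exact: (integrableZl _ a ic).
have iyc : mu.-integrable D (EFin \o (fun t => y * h dc a t)) by exact: (integrableZl _ y idc).
have iD : mu.-integrable D (EFin \o (fun t => a * h c a t + y * h dc a t)).
  exact: (integrableD _ iac iyc).
pose F t := t `^ a * c (y * ln t) * expR (- t).
pose f t := (a * h c a t + y * h dc a t) - h c (a + 1) t.
have iF : mu.-integrable D (EFin \o f) by exact: (integrableB _ iD icS).
have dF (t : R) : 0 < t -> is_derive t 1 F (f t).
  move=> t0; apply: is_derive_eq (is_deriveM_fun (is_deriveM_fun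
    (is_derive_powR a t0) (is_derive_phase t0 (hc _))) (is_derive_expRN t)) _.
  rewrite /f /h addrK.
  have -> : t `^ a = t * t `^ (a - 1) by rewrite mulr_powRB1// ltW.
  by field; rewrite gt_eqF.
have cf (t : R) : 0 < t -> {for t, continuous f}.
  move=> t0; apply: cvgB; first apply: cvgD.
  - apply: cvgM; first exact: cvg_cst.
    exact: (@continuous_gamma_integrand _ _ y c dc t hc t0).
  - apply: cvgM; first exact: cvg_cst.
    exact: (@continuous_gamma_integrand _ _ y dc ddc t hdc t0).
  - exact: (@continuous_gamma_integrand _ _ y c dc t hc t0).
have F_le t : - (t `^ a * expR (- t)) <= F t <= t `^ a * expR (- t).
  rewrite -ler_norml /F !normrM (ger0_norm (powR_ge0 _ _)) (ger0_norm (expR_ge0 _)).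
  by rewrite ler_wpM2r ?expR_ge0// ler_piMr ?powR_ge0.
have sq (G : set_system R) : Filter G ->
    t `^ a * expR (- t) @[t --> G] --> (0 : R) -> F t @[t --> G] --> (0 : R).
  move=> FG h0; apply: (@squeeze_cvgr _ _ _ _ (fun t => - (t `^ a * expR (- t)))
    (fun t => t `^ a * expR (- t))) => //.
  - exact: nearW.
  - by rewrite -oppr0; exact: cvgN.
have F0 := sq _ _ (cvg0_powR_expRN a0).
have Fy := sq _ _ (cvgy_powR_expRN a0).
have I0 : Rintegral mu D f = 0.
  by rewrite /Rintegral (integral0y_deriv iF cf dF (F0 _) (Fy _)) subrr.
apply/esym/eqP; rewrite -subr_eq0; apply/eqP; rewrite -[RHS]I0.
by rewrite RintegralB// RintegralD// !RintegralZl.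
Qed.

Lemma GammaC_cosE (a y : R) : (GammaC (a, y)).1 = W cos a y. Proof. by []. Qed.
Lemma GammaC_sinE (a y : R) : (GammaC (a, y)).2 = W sin a y. Proof. by []. Qed.
Lemma GammaRE (a : R) : GammaR a = W cos a 0. Proof. by []. Qed.

Lemma norm_cos_le1 (u : R) : `|cos u| <= 1. Proof. by rewrite ler_norml cos_geN1 cos_le1. Qed.
Lemma norm_sin_le1 (u : R) : `|sin u| <= 1. Proof. by rewrite ler_norml sin_geN1 sin_le1. Qed.
Lemma norm_Nsin_le1 (u : R) : `|- sin u| <= 1. Proof. by rewrite normrN norm_sin_le1. Qed.

Lemma GammaC_cosS (a y : R) : 0 < a -> W cos (a + 1) y = a * W cos a y - y * W sin a y.
Proof.
move=> a0; rewrite (oscillating_gammaS _ a0 (@is_derive_cos R) is_derive_Nsin norm_cos_le1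
  norm_Nsin_le1).
by rewrite (oscillating_gammaN _ a0 (@is_derive_sin R) norm_sin_le1) mulrN.
Qed.

Lemma GammaC_sinS (a y : R) : 0 < a -> W sin (a + 1) y = a * W sin a y + y * W cos a y.
Proof.
move=> a0.
exact: (oscillating_gammaS _ a0 (@is_derive_sin R) (@is_derive_cos R) norm_sin_le1 norm_cos_le1).
Qed.

Lemma GammaRS (a : R) : 0 < a -> GammaR (a + 1) = a * GammaR a.
Proof. by move=> a0; rewrite !GammaRE GammaC_cosS// mul0r subr0. Qed.

Lemma integrable_GammaR (a : R) : 0 < a ->
  mu.-integrable D (EFin \o (fun t => t `^ (a - 1) * expR (- t))).
Proof.
move=> a0; have := @integrable_gamma R a 0 _ _ a0 (@is_derive_cos R) norm_cos_le1.
by apply: eq_integrable => // t _; rewrite /= mul0r cos0 mulr1.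
Qed.

Lemma GammaR_integral (a : R) : GammaR a = Rintegral mu D (fun t => t `^ (a - 1) * expR (- t)).
Proof. by rewrite GammaRE; apply: eq_Rintegral => t _; rewrite mul0r cos0 mulr1. Qed.

Lemma oscillating_gamma_le (c dc : R -> R) (a y : R) : 0 < a ->
  (forall u : R, is_derive u 1 c (dc u)) -> (forall u : R, `|c u| <= 1) ->
  `|W c a y| <= GammaR a.
Proof.
move=> a0 hc c1; have ic := @integrable_gamma R a y _ _ a0 hc c1.
rewrite GammaR_integral (le_trans (le_normr_Rintegral _ ic))//.
apply: le_Rintegral => //; first exact: integrable_norm.
  exact: integrable_GammaR.
move=> t _; rewrite !normrM (ger0_norm (powR_ge0 _ _)) (ger0_norm (expR_ge0 _)).
by rewrite ler_wpM2r ?expR_ge0// ler_piMr ?powR_ge0.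
Qed.

Lemma GammaR_gt0 (a : R) : 0 < a -> 0 < GammaR a.
Proof.
(* On [[1, 2]] one has [0 <= ln t <= 2] and [t <= 2], so the integrand is at least [m] there, and
   the interval has length one. *)
move=> a0; rewrite GammaR_integral; pose m := expR (- (`|a - 1| * 2) - 2).
have i0 := integrable_GammaR a0.
rewrite (@lt_le_trans _ _ m) ?expR_gt0// -lee_fin /Rintegral fineK ?integrable_fin_num//.
have -> : m%:E = (\int[mu]_(t in `[1%R, 2%R]) (cst m%:E) t)%E.
  rewrite integral_cst//= lebesgue_measure_itv/= lte_fin ltr1n -EFinB.
  by rewrite -EFinM (_ : 2 - 1 = 1 :> R) ?mulr1//; ring.
have sub : `[1%R, 2%R] `<=` D.
  by move=> t; rewrite /= !in_itv/= andbT => /andP[+ _]; exact: lt_le_trans.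
apply: (@le_trans _ _ (\int[mu]_(t in `[1%R, 2%R]) (t `^ (a - 1) * expR (- t))%:E)%E).
  apply: le_integral => //.
  - apply: measurable_bounded_integrable => //.
      by rewrite /= lebesgue_measure_itv/= lte_fin ltr1n -EFinB ltry.
    by exists m; split; [exact: num_real|move=> M mM t _; rewrite /= gtr0_norm ?expR_gt0// ltW].
  - exact: integrableS i0.
  - move=> t; rewrite inE/= in_itv/= => /andP[t1 t2]; rewrite lee_fin.
    have t0 : 0 < t by exact: lt_le_trans t1.
    rewrite /powR gt_eqF// -expRD ler_expR lerD//; last by rewrite lerN2.
    rewrite lerNl -mulNr (le_trans (ler_wpM2r (ln_ge0 t1) (ler_norm _)))//.
    rewrite normrN ler_wpM2l// (le_trans _ t2)//; exact/ltW/ln_sublinear.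
apply: ge0_subset_integral => //.
- exact: (measurable_int _ i0).
- by move=> t _; rewrite lee_fin mulr_ge0 ?powR_ge0 ?expR_ge0.
Qed.

(* Two steps of [Gamma (s + 1) = s Gamma s] gain a factor [1 / y ^ 2].  The pairs
   [(Re Gamma, Im Gamma)] and [(Im Gamma, - Re Gamma)] obey the same recurrence. *)
Lemma decay_of_recurrence (a y c0 s0 c1 s1 c2 G0 G1 G2 : R) : 0 < a ->
  c1 = a * c0 - y * s0 -> s1 = a * s0 + y * c0 -> c2 = (a + 1) * c1 - y * s1 ->
  `|c0| <= G0 -> `|c1| <= G1 -> `|c2| <= G2 ->
  `|c0| <= (G0 + (a + 1) * G1 + G2 + a * (a * G0) + a * G1) / (1 + y ^+ 2).
Proof.
move=> a0 c1E s1E c2E b0 b1 b2; have y20 : 0 < 1 + y ^+ 2 by rewrite ltr_wpDr// sqr_ge0.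
rewrite ler_pdivlMr// -[X in _ * X](gtr0_norm y20) -normrM.
(* The relations [y s0 = a c0 - c1] and [y s1 = (a + 1) c1 - c2] eliminate [s0] and [s1] and express
   [y ^ 2 c0] through [c0], [c1], [c2]. *)
have -> : c0 * (1 + y ^+ 2) = c0 + (a + 1) * c1 - c2 - a * (a * c0) + a * c1.
  by rewrite c2E s1E c1E; ring.
have nb z B : `|z| <= B -> `|a * z| <= a * B.
  by move=> zB; rewrite normrM gtr0_norm// ler_wpM2l// ltW.
have := nb _ _ b1; have := nb _ _ (nb _ _ b0).
move: b0 b1 b2; rewrite !ler_norml !mulrDl !mul1r.
move: (a * c1) (a * (a * c0)) (a * G1) (a * (a * G0)) => u v U V.
by move=> /andP[? ?] /andP[? ?] /andP[? ?] /andP[? ?] /andP[? ?]; apply/andP; split; lra.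
Qed.

Lemma GammaC_decay (a : R) : 0 < a -> exists2 K : R, 0 <= K & forall y : R,
  `|W cos a y| <= K / (1 + y ^+ 2) /\ `|W sin a y| <= K / (1 + y ^+ 2).
Proof.
move=> a0; have a10 : 0 < a + 1 by rewrite addr_gt0.
have a20 : 0 < a + 1 + 1 by rewrite addr_gt0.
have bC b y : 0 < b -> `|W cos b y| <= GammaR b.
  by move=> b0; exact: (oscillating_gamma_le _ b0 (@is_derive_cos R) norm_cos_le1).
have bS b y : 0 < b -> `|W sin b y| <= GammaR b.
  by move=> b0; exact: (oscillating_gamma_le _ b0 (@is_derive_sin R) norm_sin_le1).
have bN b y : 0 < b -> `|- W cos b y| <= GammaR b by move=> b0; rewrite normrN; exact: bC.
have key y : let K := GammaR a + (a + 1) * GammaR (a + 1) + GammaR (a + 1 + 1) +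
    a * (a * GammaR a) + a * GammaR (a + 1) in
    `|W cos a y| <= K / (1 + y ^+ 2) /\ `|W sin a y| <= K / (1 + y ^+ 2).
  split.
    exact: (decay_of_recurrence a0 (GammaC_cosS y a0) (GammaC_sinS y a0) (GammaC_cosS y a10)
      (bC _ y a0) (bC _ y a10) (bC _ y a20)).
  apply: (@decay_of_recurrence a y (W sin a y) (- W cos a y) (W sin (a + 1) y)
    (- W cos (a + 1) y) (W sin (a + 1 + 1) y) _ _ _ a0 _ _ _
    (bS _ y a0) (bS _ y a10) (bS _ y a20)).
  - by rewrite mulrN opprK GammaC_sinS.
  - by rewrite GammaC_cosS// mulrN opprB addrC.
  - by rewrite mulrN opprK GammaC_sinS.
eexists; last exact: key.
have := ltW (GammaR_gt0 a0); have := ltW (GammaR_gt0 a10); have := ltW (GammaR_gt0 a20).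
move: (GammaR a) (GammaR (a + 1)) (GammaR (a + 1 + 1)) => g0 g1 g2 h2 h1 h0.
by rewrite !addr_ge0// !mulr_ge0// ltW.
Qed.

Lemma continuous_oscillating_gamma (c dc : R -> R) (a : R) : 0 < a ->
  (forall u : R, is_derive u 1 c (dc u)) -> (forall u : R, `|c u| <= 1) ->
  continuous (W c a).
Proof.
move=> a0 hc c1 y.
have cc (u : R) : {for u, continuous c} by exact: is_derive_continuous (hc u).
have mD : measurable (D : set (measurableTypeR R)) by exact: measurable_itv.
have iy (z : R) : `]y - 1, y + 1[%classic z ->
    mu.-integrable D (EFin \o (fun t => t `^ (a - 1) * c (z * ln t) * expR (- t))).
  by move=> _; exact: integrable_gamma hc c1.
apply: (@continuity_under_integral R _ _ mu
   (fun z t => t `^ (a - 1) * c (z * ln t) * expR (- t)) D mD (y - 1) (y + 1) iy _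
   (fun t => t `^ (a - 1) * expR (- t)) (integrable_GammaR a0) _ y _).
- apply: aeW => t _ z _.
  apply: cvgM; last exact: cvg_cst.
  apply: cvgM; first exact: cvg_cst.
  apply: (@cvg_comp _ _ _ (fun z : R => z * ln t) c _ (nbhs (z * ln t))); last exact: cc.
  by apply: cvgM; [exact: cvg_id|exact: cvg_cst].
- move=> z _; apply: aeW => t _.
  rewrite !normrM (ger0_norm (powR_ge0 _ _)) (ger0_norm (expR_ge0 _)).
  by rewrite ler_wpM2r ?expR_ge0// ler_piMr ?powR_ge0.
- by rewrite inE/= in_itv/= ltrBlDr ltrDl ltr01.
Qed.

Lemma integrable_inv_oneDsqr (K : R) :
  mu.-integrable setT (EFin \o (fun y : R => K / (1 + y ^+ 2))).
Proof.
have i1 : mu.-integrable setT (EFin \o (fun y : R => (1 + y ^+ 2)^-1)).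
  apply/integrableP; split.
    apply/measurable_EFinP; apply: continuous_measurable_fun.
    exact: continuous_oneDsqrV.
  under eq_integral => y _ do rewrite /= ger0_norm ?invr_ge0 ?(le_trans ler01 (oneDsqr_ge1 _))//.
  rewrite (@ge0_symfun_integralT _ (fun y : R => (1 + y ^+ 2)^-1)).
  - rewrite (_ : [set x | _] = `[0%R, +oo[%classic); last first.
      by apply/seteqP; split => x/=; rewrite in_itv/= andbT.
    by rewrite (@integral0y_oneDsqr R) -EFinM ltry.
  - by move=> y; rewrite invr_ge0 (le_trans ler01 (oneDsqr_ge1 y)).
  - exact: continuous_oneDsqrV.
  - by move=> y /=; rewrite sqrrN.
exact: (integrableZl _ K i1).
Qed.

End GammaDecay.

(** * Mellin inversion of the Gamma function *)

Section Swap.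
Context {R : realType}.
Notation mu := (@lebesgue_measure R).
Notation D := (`]0%R, +oo[%classic : set R).

(** Fubini, with integrability of the double integral read off from a product bound. The indicators
    of [A] and [B] carry both integrals to the whole line, where the theorem on the product measure
    applies. *)
Lemma Rintegral_swap (A B : set (measurableTypeR R)) (f : R -> R -> R) (p q : R -> R) :
  measurable A -> measurable B -> measurable_fun setT (fun z : R * R => f z.1 z.2) ->
  mu.-integrable A (EFin \o p) -> mu.-integrable B (EFin \o q) ->
  (forall y t, A y -> B t -> `|f y t| <= p y * q t) ->
  Rintegral mu A (fun y => Rintegral mu B (f y)) =
  Rintegral mu B (fun t => Rintegral mu A (fun y => f y t)).
Proof.
move=> mA mB mf ip iq fpq.
have mfy y : measurable_fun setT (f y) by exact: (measurableT_comp mf (pair1_measurable y)).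
have mft t : measurable_fun setT (f^~ t) by exact: (measurableT_comp mf (pair2_measurable t)).
have ify y : A y -> mu.-integrable B (EFin \o f y).
  move=> Ay; apply: (le_integrable mB _ _ (integrableZl mB (p y) iq)).
    by apply/measurable_EFinP; apply: measurable_funTS; exact: mfy.
  move=> t Bt; rewrite lee_fin /= (le_trans (fpq _ _ Ay Bt))//.
  exact: ler_norm.
have ift t : B t -> mu.-integrable A (EFin \o f^~ t).
  move=> Bt; apply: (le_integrable mA _ _ (integrableZl mA (q t) ip)).
    by apply/measurable_EFinP; apply: measurable_funTS; exact: mft.
  move=> y Ay; rewrite lee_fin /= (le_trans (fpq _ _ Ay Bt))// mulrC.
  exact: ler_norm.
pose F (z : R * R) := (f z.1 z.2 * (\1_A z.1 * \1_B z.2))%:E.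
have mF : measurable_fun setT F.
  apply/measurable_EFinP; apply: measurable_funM => //.
  apply: measurable_funM.
    by apply: measurableT_comp => //; exact: measurable_indic.
  by apply: measurableT_comp => //; exact: measurable_indic.
have FA y : (\int[mu]_t F (y, t) = (\int[mu]_(t in B) (f y t)%:E) * (\1_A y)%:E)%E.
  rewrite [in RHS]integral_mkcond; have [yA|yA] := boolP (y \in A).
    rewrite indicE yA mule1; apply: eq_integral => t _.
    rewrite /F/= indicE yA mul1r patchE indicE; case: (t \in B); rewrite ?mulr1 ?mulr0//.
  rewrite indicE (negbTE yA) mule0; apply: integral0_eq => t _.
  by rewrite /F/= indicE (negbTE yA) mul0r mulr0.
have FB t : (\int[mu]_y F (y, t) = (\int[mu]_(y in A) (f y t)%:E) * (\1_B t)%:E)%E.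
  rewrite [in RHS]integral_mkcond; have [tB|tB] := boolP (t \in B).
    rewrite [in RHS]indicE tB mule1; apply: eq_integral => y _.
    rewrite /F/= [X in _ * (_ * X)]indicE tB mulr1 patchE indicE; case: (y \in A);
      rewrite ?mulr1 ?mulr0//.
  rewrite [in RHS]indicE (negbTE tB) mule0; apply: integral0_eq => y _.
  by rewrite /F/= [X in _ * (_ * X)]indicE (negbTE tB) !mulr0.
have iF : (mu \x mu)%E.-integrable setT F.
  apply/integrable12ltyP => //.
  pose P := (EFin \o p) \_ A; pose Q := (EFin \o q) \_ B.
  have iP : mu.-integrable setT P by apply/(integrable_mkcond _ mA).
  have iQ : mu.-integrable setT Q by apply/(integrable_mkcond _ mB).
  have /integrableP[mP lP] := iP; have /integrableP[mQ lQ] := iQ.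
  have FPQ y t : (`|F (y, t)| <= `|P y| * `|Q t|)%E.
    rewrite /F /P /Q !patchE /= !indicE.
    have [yA|yA] := boolP (y \in A); last by rewrite /= mulr0n mul0r mulr0 normr0;
      by apply: mule_ge0; rewrite ?lexx ?abse_ge0.
    have [tB|tB] := boolP (t \in B); last by rewrite /= ?mulr0n !mulr0 normr0;
      by apply: mule_ge0; rewrite ?lexx ?abse_ge0.
    rewrite /= ?mulr1n ?mulr1 lee_fin (le_trans (fpq _ _ (set_mem yA) (set_mem tB)))//.
    by rewrite -normrM ler_norm.
  have step y : (\int[mu]_t `|F (y, t)| <= `|P y| * \int[mu]_t `|Q t|)%E.
    rewrite -ge0_integralZl//; last exact: measurableT_comp.
    apply: ge0_le_integral => //.
    - by apply: measurableT_comp => //; exact: (measurableT_comp mF (pair1_measurable y)).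
    - by apply: measurable_funeM; exact: measurableT_comp.
  apply: (@le_lt_trans _ _ (\int[mu]_y (`|P y| * \int[mu]_t `|Q t|))%E).
    apply: ge0_le_integral => //.
    - by move=> y _; exact: integral_ge0.
    - have mabs : measurable_fun setT (abse \o F) by exact: measurableT_comp.
      refine (measurable_fun_fubini_tonelli_F (m2 := mu) (abse \o F) mabs _).
      by move=> z; exact: abse_ge0.
    - apply: emeasurable_funM => //; exact: measurableT_comp.
  rewrite ge0_integralZr//; [|exact: measurableT_comp|exact: integral_ge0].
  by rewrite lte_mul_pinfty ?integral_ge0// ge0_fin_numE// integral_ge0.
have := Fubini iF.
under eq_integral do rewrite FA.
under [X in _ = X -> _]eq_integral do rewrite FB.
move=> H; congr fine.
transitivity (\int[mu]_y ((\int[mu]_(t in B) (f y t)%:E) * (\1_A y)%:E))%E.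
  rewrite integral_mkcond; apply: eq_integral => y _; rewrite patchE indicE.
  case: ifPn => yA; rewrite ?mule0// mule1 /Rintegral fineK//.
  exact: integrable_fin_num (ify _ (set_mem yA)).
rewrite H [in RHS]integral_mkcond; apply: eq_integral => t _; rewrite patchE indicE.
case: ifPn => tB; rewrite ?mule0// mule1 /Rintegral fineK//.
exact: integrable_fin_num (ift _ (set_mem tB)).
Qed.

End Swap.

(** * Laplace transform of the cosine, and a Poisson kernel in [ln t] *)

Section PoissonKernel.
Context {R : realType}.
Notation mu := (@lebesgue_measure R).
Notation D := (`]0%R, +oo[%classic : set R).

Lemma is_deriveZ_fun (k : R) (f : R -> R) (x df : R) :
  is_derive x 1 f df -> is_derive x 1 (fun t => k * f t) (k * df).
Proof. by move=> hf; exact: (is_deriveZ k hf). Qed.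

Lemma cvgy_expRN (e : R) : 0 < e -> expR (- (e * x)) @[x --> +oo] --> (0 : R).
Proof.
move=> e0; have h : (e * x : R) @[x --> +oo] --> +oo.
  apply/cvgryPge => A; near=> t; rewrite mulrC -ler_pdivrMr//.
exact: (@cvg_comp _ _ _ (fun x : R => e * x) (fun x => expR (- x)) _ _ _ h (@cvgr_expR R)).
Unshelve. all: by end_near. Qed.

Let dexp (e x : R) : is_derive x 1 (fun t => expR (- (e * t))) (- e * expR (- (e * x))).
Proof.
have d1 : is_derive x 1 (fun t : R => - (e * t)) (- e).
  have d0 : is_derive x 1 (fun t : R => e * t) (e *: 1).
    exact: (is_deriveZ e (is_derive_id x 1)).
  have -> : - e = - (e *: 1) by rewrite /GRing.scale/= mulr1.
  exact: (is_deriveN d0).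
by rewrite mulrC; exact: (is_derive_comp_fun (is_derive_expR _) d1).
Qed.

Lemma integrable_expRN (e : R) : 0 < e -> mu.-integrable D (EFin \o (fun t => expR (- (e * t)))).
Proof.
move=> e0; have cf (x : R) : 0 < x -> {for x, continuous (fun t => expR (- (e * t)))}.
  by move=> _; exact: is_derive_continuous (dexp e x).
apply/integrableP; split.
  by apply/measurable_EFinP; exact: continuous_pos_measurable.
under eq_integral => x _ do rewrite /= ger0_norm ?expR_ge0//.
rewrite (_ : (\int[mu]_(x in D) _)%E = (- e^-1 * 0 - (- e^-1 * 1))%:E) ?ltry//.
apply: (@ge0_integral0y_deriv _ (fun t => - e^-1 * expR (- (e * t)))).
- by move=> x _; exact: expR_ge0.
- exact: cf.
- move=> x _; apply: is_derive_eq (is_deriveZ_fun (- e^-1) (dexp e x)) _.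
  by rewrite /GRing.scale/=; field; rewrite gt_eqF.
- apply: cvgM; first exact: cvg_cst.
  apply: cvg_at_right_filter; rewrite -[X in _ --> X]expR0.
  have -> : expR 0 = expR (- (e * 0)) :> R by rewrite mulr0 oppr0.
  exact: is_derive_continuous (dexp e 0).
- by apply: cvgM; [exact: cvg_cst|exact: cvgy_expRN].
Qed.

Lemma laplace_cos (e u : R) : 0 < e ->
  Rintegral mu D (fun y => expR (- (e * y)) * cos (y * u)) = e / (e ^+ 2 + u ^+ 2).
Proof.
move=> e0; have q0 : e ^+ 2 + u ^+ 2 != 0.
  by rewrite gt_eqF// ltr_wpDr ?sqr_ge0// exprn_gt0.
have dlin (x : R) : is_derive x 1 (fun t : R => t * u) u.
  apply: is_derive_eq (is_deriveM_fun (is_derive_id x 1) (is_derive_cst u x 1)) _.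
  by rewrite mul1r mulr0 addr0.
have dcos (x : R) : is_derive x 1 (fun t => cos (t * u)) (- sin (x * u) * u).
  exact: (is_derive_comp_fun (g := fun t : R => t * u) (is_derive_cos _) (dlin x)).
have dsin (x : R) : is_derive x 1 (fun t => sin (t * u)) (cos (x * u) * u).
  exact: (is_derive_comp_fun (g := fun t : R => t * u) (is_derive_sin _) (dlin x)).
(* The real part of [exp ((- e + i u) t) / (- e + i u)]. *)
pose F t := (e ^+ 2 + u ^+ 2)^-1 * (expR (- (e * t)) * (u * sin (t * u) - e * cos (t * u))).
have dF (x : R) : is_derive x 1 F (expR (- (e * x)) * cos (x * u)).
  have dB : is_derive x 1 (fun t => u * sin (t * u) - e * cos (t * u))
      (u * (cos (x * u) * u) - e * (- sin (x * u) * u)).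
    exact: (is_deriveB (is_deriveZ_fun u (dsin x)) (is_deriveZ_fun e (dcos x))).
  apply: is_derive_eq (is_deriveZ_fun (e ^+ 2 + u ^+ 2)^-1 (is_deriveM_fun (dexp e x) dB)) _.
  by rewrite /GRing.scale/=; field.
have cf (x : R) : {for x, continuous (fun y => expR (- (e * y)) * cos (y * u))}.
  exact: is_derive_continuous (is_deriveM_fun (dexp e x) (dcos x)).
rewrite /Rintegral (_ : (\int[mu]_(x in D) _)%E =
  ((e ^+ 2 + u ^+ 2)^-1 * 0 - (- e / (e ^+ 2 + u ^+ 2)))%:E).
  by rewrite /= mulr0 sub0r mulNr opprK.
apply: (@integral0y_deriv _ F).
- apply: (le_integrable _ _ _ (integrable_expRN e0)) => //.
    by apply/measurable_EFinP; apply: continuous_pos_measurable => x _; exact: cf.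
  move=> y _; rewrite lee_fin /= normrM ler_piMr// norm_cos_le1//.
- by move=> x _; exact: cf.
- apply: cvg_at_right_filter.
  have -> : - e / (e ^+ 2 + u ^+ 2) = F 0.
    by rewrite /F mulr0 oppr0 expR0 mul0r sin0 cos0 mulr0 mulr1 sub0r mul1r mulrC.
  exact: is_derive_continuous (dF 0).
- apply: cvgM; first exact: cvg_cst.
  pose B := `|u| + `|e|.
  apply: (@squeeze_cvgr _ _ _ _ (fun t => - (B * expR (- (e * t)))) (fun t => B * expR (- (e *
    t)))).
  + near=> t; rewrite -ler_norml normrM (ger0_norm (expR_ge0 _)) mulrC ler_wpM2r ?expR_ge0//.
    rewrite (le_trans (ler_normB _ _))// lerD// normrM ler_piMr// ?norm_cos_le1 ?norm_sin_le1//.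
  + rewrite -[X in _ --> X]oppr0 -[X in - X](mulr0 B); apply: cvgN; apply: cvgM;
      [exact: cvg_cst|exact: cvgy_expRN].
  + rewrite -[X in _ --> X](mulr0 B); apply: cvgM; [exact: cvg_cst|exact: cvgy_expRN].
Unshelve. all: by end_near. Qed.

(* Mass pi for every [e > 0]: the substitution [u = ln (t / x) / e] turns it
   into [1 / (1 + u ^ 2)]. *)
Definition log_poisson (x e t : R) : R := e / (e ^+ 2 + (ln t - ln x) ^+ 2) / t.

Lemma log_poisson_ge0 (x e t : R) : 0 < e -> 0 < t -> 0 <= log_poisson x e t.
Proof.
by move=> e0 t0; rewrite !divr_ge0 ?addr_ge0 ?sqr_ge0// ltW.
Qed.

Let lp_den (x e t : R) : 0 < e -> e ^+ 2 + (ln t - ln x) ^+ 2 != 0.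
Proof. by move=> e0; rewrite gt_eqF// ltr_wpDr ?sqr_ge0// exprn_gt0. Qed.

Let dln (x e t : R) : 0 < t -> is_derive t 1 (fun t => (ln t - ln x) / e) (t^-1 / e).
Proof.
move=> t0; have d1 : is_derive t 1 (fun t : R => ln t - ln x) (t^-1 - 0).
  exact: (is_deriveB (is_derive1_ln t0) (is_derive_cst (ln x) t 1)).
apply: is_derive_eq (is_deriveM_fun d1 (is_derive_cst e^-1 t 1)) _.
by rewrite mulr0 addr0 subr0.
Qed.

Lemma continuous_log_poisson (x e t : R) : 0 < e -> 0 < t -> {for t, continuous (log_poisson x
  e)}.
Proof.
move=> e0 t0; have cl : {for t, continuous (fun t => ln t - ln x)}.
  by apply: cvgB; [exact: continuous_ln|exact: cvg_cst].
apply: cvgM; last by apply: cvgV; [rewrite gt_eqF|exact: cvg_id].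
apply: cvgM; first exact: cvg_cst.
apply: cvgV; first exact: lp_den.
apply: cvgD; first exact: cvg_cst.
by apply: (@cvg_comp _ _ _ (fun t : R => ln t - ln x) (fun u => u ^+ 2) _ _ _ cl);
  exact: exprn_continuous.
Qed.

Lemma integral_log_poisson (x e : R) : 0 < e ->
  (\int[mu]_(t in D) (log_poisson x e t)%:E = pi%:E)%E.
Proof.
move=> e0; have cvgNy_atan : (@atan R) z @[z --> -oo] --> - (pi / 2).
  apply/cvgNy_compNP; rewrite (_ : atan \o -%R = -%R \o atan); last first.
    by apply/funext => z /=; rewrite atanN.
  exact: (cvgN (@cvgy_atan R)).
have lny : (ln t - ln x) / e @[t --> +oo] --> +oo.
  apply/cvgryPge => A; near=> t.
  have t0 : 0 < t by near: t; exact: nbhs_pinfty_gt.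
  rewrite ler_pdivlMr// lerBrDr -ler_expR lnK ?posrE//.
have ln0y : (ln t - ln x) / e @[t --> 0^'+] --> -oo.
  apply/cvgrNyPle => A; near=> t.
  have t0 : 0 < t by near: t; exact: nbhs_right_gt.
  rewrite ler_pdivrMr// lerBlDr -ler_expR lnK ?posrE//.
  by near: t; apply: nbhs_right_le; exact: expR_gt0.
rewrite [in RHS](_ : pi = pi / 2 - (- (pi / 2))); last by field.
apply: (@ge0_integral0y_deriv _ (fun t => atan ((ln t - ln x) / e))).
- by move=> t t0; exact: log_poisson_ge0.
- by move=> t t0; exact: continuous_log_poisson.
- move=> t t0.
  apply: is_derive_eq (is_derive_comp_fun (g := fun t => (ln t - ln x) / e) (is_derive1_atan _)
    (dln x e t0)) _.
  rewrite /log_poisson; field; rewrite lp_den// !gt_eqF//.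
- exact: (@cvg_comp _ _ _ (fun t => (ln t - ln x) / e) (@atan R) _ _ _ ln0y cvgNy_atan).
- exact: (@cvg_comp _ _ _ (fun t => (ln t - ln x) / e) (@atan R) _ _ _ lny (@cvgy_atan R)).
Unshelve. all: by end_near. Qed.

End PoissonKernel.

(** * Inversion by Abel summation *)

Section Inversion.
Context {R : realType}.
Notation mu := (@lebesgue_measure R).
Notation D := (`]0%R, +oo[%classic : set R).

Notation W := oscillating_gamma.

Lemma integrable_log_poisson (x e : R) : 0 < e ->
  mu.-integrable D (EFin \o log_poisson x e).
Proof.
move=> e0; apply/integrableP; split.
  by apply/measurable_EFinP; apply: continuous_pos_measurable => t t0;
    exact: continuous_log_poisson.
under eq_integral => t.
  rewrite inE/= in_itv/= andbT => t0; rewrite ger0_norm ?log_poisson_ge0//; over.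
by rewrite integral_log_poisson// ltry.
Qed.

Lemma Rintegral_log_poisson (x e : R) : 0 < e -> Rintegral mu D (log_poisson x e) = pi.
Proof. by move=> e0; rewrite /Rintegral integral_log_poisson. Qed.

Section MellinInversion.
Variables (b x : R).
Hypotheses (b0 : 0 < b) (x0 : 0 < x).

Let g (t : R) : R := t `^ b * expR (- t).

(** The real part of [Gamma (b + i y) x ^ (- i y)]. *)
Let h (y : R) : R := W cos b y * cos (y * ln x) + W sin b y * sin (y * ln x).

Let q (t : R) : R := t `^ (b - 1) * expR (- t).

Let qE (t : R) : 0 < t -> q t = g t / t.
Proof.
move=> t0; rewrite /q /g -(mulr_powRB1 (ltW t0) b0); field; exact: lt0r_neq0.
Qed.

Let g_ge0 (t : R) : 0 <= g t. Proof. by rewrite mulr_ge0 ?powR_ge0 ?expR_ge0. Qed.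

Let g_le (t : R) : 0 <= t -> g t <= b `^ b.
Proof. by move=> t0; exact: powR_expRN_le. Qed.

Let continuous_g (t : R) : 0 < t -> {for t, continuous g}.
Proof.
move=> t0; exact: (is_derive_continuous (is_deriveM_fun (is_derive_powR b t0) (is_derive_expRN
  t))).
Qed.

Let hE (y : R) : h y = Rintegral mu D (fun t => q t * cos (y * (ln t - ln x))).
Proof.
have ic := @integrable_gamma R b y _ _ b0 (@is_derive_cos R) norm_cos_le1.
have isn := @integrable_gamma R b y _ _ b0 (@is_derive_sin R) norm_sin_le1.
rewrite /h /oscillating_gamma -!RintegralZr// -RintegralD//; last 2 first.
- exact: (integrableZr _ (cos (y * ln x)) ic).
- exact: (integrableZr _ (sin (y * ln x)) isn).
apply: eq_Rintegral => t _; rewrite mulrBr cosB /q; ring.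
Qed.

Let measurable_kernel : measurable_fun setT (fun z : R * R => q z.2 * cos (z.1 * (ln z.2 - ln
  x))).
Proof.
apply: measurable_funM.
  apply: (measurableT_comp (f := q)) => //; apply: measurable_funM.
    exact: measurable_powR.
  by apply: measurableT_comp => //; exact: measurable_expR.
apply: measurableT_comp; first by apply: continuous_measurable_fun; exact: continuous_cos.
apply: measurable_funM => //; apply: measurable_funB => //.
by apply: (measurableT_comp (@measurable_ln R)).
Qed.

(* The inversion integral does not converge absolutely as a double integral;
   the factor [exp (- e y)] makes Fubini applicable. *)
Let J (e : R) : R := Rintegral mu D (fun y => expR (- (e * y)) * h y).

(** After the exchange, the integral over [y] is the Laplace transform of [cos (y u)] with
    [u = ln t - ln x]; the factor [1 / t] in [q t = g t / t] completes the Poisson kernel. *)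
Let JE (e : R) : 0 < e -> J e = Rintegral mu D (fun t => g t * log_poisson x e t).
Proof.
move=> e0; have iq := integrable_GammaR b0.
transitivity (Rintegral mu D (fun y => Rintegral mu D (fun t =>
    expR (- (e * y)) * (q t * cos (y * (ln t - ln x)))))).
  apply: eq_Rintegral => y _; rewrite hE -RintegralZl//.
  apply: (le_integrable _ _ _ iq) => //.
    apply/measurable_EFinP; apply: measurable_funTS.
    exact: (measurableT_comp measurable_kernel (pair1_measurable y)).
  by move=> t _; rewrite lee_fin /= normrM ler_piMr// norm_cos_le1.
rewrite (@Rintegral_swap _ D D
  (fun y t => expR (- (e * y)) * (q t * cos (y * (ln t - ln x))))
  (fun y => expR (- (e * y))) q) //.
- apply: eq_Rintegral => t; rewrite inE/= in_itv/= andbT => t0.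
  transitivity (Rintegral mu D (fun y => q t * (expR (- (e * y)) * cos (y * (ln t - ln x))))).
    by apply: eq_Rintegral => y _; ring.
  rewrite RintegralZl//.
    by rewrite laplace_cos// qE// /log_poisson; ring.
  apply: (le_integrable _ _ _ (integrable_expRN e0)) => //.
    apply/measurable_EFinP; apply: measurable_funTS; apply: measurable_funM.
      apply: measurableT_comp => //; apply: measurableT_comp => //.
    apply: measurableT_comp; first by apply: continuous_measurable_fun; exact: continuous_cos.
    exact: measurable_funM.
  by move=> y _; rewrite lee_fin /= normrM ler_piMr// norm_cos_le1.
- apply: measurable_funM => //.
  by apply: measurableT_comp => //; apply: measurableT_comp => //; apply: measurable_funM.
- exact: integrable_expRN.
- move=> y t _ _; rewrite normrM (ger0_norm (expR_ge0 _)) ler_wpM2l ?expR_ge0//.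
  rewrite normrM [`|q t|]ger0_norm ?mulr_ge0 ?powR_ge0 ?expR_ge0//.
  by rewrite ler_piMr ?norm_cos_le1// mulr_ge0 ?powR_ge0 ?expR_ge0.
Qed.

(* Pointwise [|g t - g x| K_e t <= eta K_e t + e C K_1 t] for the Poisson kernel [K_e]:
   the first term suffices near [x], the second one away from it. *)
Let J_approx (eta : R) : 0 < eta ->
  exists C : R, forall e : R, 0 < e -> `|J e - pi * g x| <= eta * pi + e * C.
Proof.
move=> eta0.
(* Continuity of [g] is used in the variable [u = ln t], since the kernel measures the distance of
   [t] from [x] by [ln t - ln x]. *)
have /cvgrPdist_lt /(_ _ eta0)[d /= d0 hd] :
    {for ln x, continuous (fun u => expR (b * u) * expR (- expR u))}.
  apply: cvgM.
    apply: (@cvg_comp _ _ _ (fun u : R => b * u) expR _ (nbhs (b * ln x)));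
      last exact: continuous_expR.
    by apply: cvgM; [exact: cvg_cst|exact: cvg_id].
  apply: (@cvg_comp _ _ _ (fun u : R => - expR u) expR _ (nbhs (- expR (ln x))));
    last exact: continuous_expR.
  by apply: cvgN; exact: continuous_expR.
have gE (t : R) : 0 < t -> g t = expR (b * ln t) * expR (- expR (ln t)).
  by move=> t0; rewrite lnK ?posrE// /g /powR gt_eqF.
pose M := b `^ b; have M0 : 0 <= M by exact: powR_ge0.
(* [M] bounds [|g t - g x|], both values lying in [[0, M]]. For [u ^ 2 >= d ^ 2] one has
   [1 + u ^ 2 <= (1 + d ^ -2) u ^ 2], which compares the kernel [K e] with [e (1 + d ^ -2)] times
   [K 1]; the mass of [K 1] is [pi]. *)
exists (M * (1 + d ^- 2) * pi) => e e0.
pose K := log_poisson x.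
have iK c : 0 < c -> mu.-integrable D (EFin \o K c) by exact: integrable_log_poisson.
have iZ k c : 0 < c -> mu.-integrable D (EFin \o (fun t => k * K c t)).
  by move=> c0; exact: (integrableZl _ k (iK c c0)).
have igK : mu.-integrable D (EFin \o (fun t => g t * K e t)).
  apply: (le_integrable _ _ _ (iZ M e e0)) => //.
    apply/measurable_EFinP; apply: continuous_pos_measurable => t t0.
    by apply: cvgM; [exact: continuous_g|exact: continuous_log_poisson].
  move=> t; rewrite /= in_itv/= andbT => t0.
  have Kt : 0 <= K e t by exact: log_poisson_ge0.
  by rewrite lee_fin (ger0_norm (mulr_ge0 (g_ge0 t) Kt)) (ger0_norm (mulr_ge0 M0 Kt))
    ler_wpM2r// g_le// ltW.
have i1 : mu.-integrable D (EFin \o (fun t => g t * K e t - g x * K e t)).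
  by apply: (integrableB _ igK (iZ _ _ e0)).
have i2 : mu.-integrable D (EFin \o (fun t => eta * K e t + e * (M * (1 + d ^- 2)) * K 1 t)).
  by apply: (integrableD _ (iZ _ _ e0) (iZ _ _ ltr01)).
have -> : J e - pi * g x = Rintegral mu D (fun t => g t * K e t - g x * K e t).
  by rewrite JE// RintegralB ?iZ// RintegralZl ?iK// Rintegral_log_poisson// [pi * _]mulrC.
rewrite (le_trans (le_normr_Rintegral _ i1))//.
rewrite (_ : _ + _ = Rintegral mu D (fun t => eta * K e t + e * (M * (1 + d ^- 2)) * K 1 t));
  last first.
  rewrite RintegralD ?iZ// !RintegralZl ?iK// !Rintegral_log_poisson//; ring.
apply: le_Rintegral => //; first exact: integrable_norm.
move=> t; rewrite /= in_itv/= andbT => t0.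
have Kt : 0 <= K e t by exact: log_poisson_ge0.
have K1 : 0 <= K 1 t by exact: log_poisson_ge0.
have c0 : 0 <= e * (M * (1 + d ^- 2)).
  rewrite mulr_ge0 ?(ltW e0)// (mulr_ge0 M0)// addr_ge0// invr_ge0 exprn_ge0// ltW//.
rewrite -mulrBl normrM (ger0_norm Kt).
have [near_x|far] := ltP `|ln x - ln t| d.
  rewrite (@le_trans _ _ (eta * K e t))//.
    by rewrite ler_wpM2r// distrC ltW// !gE//; exact: hd.
  by rewrite lerDl (mulr_ge0 c0 K1).
rewrite (@le_trans _ _ (M * K e t))//.
  rewrite ler_wpM2r// ler_norml.
  have := g_ge0 t; have := g_ge0 x; have := g_le (ltW t0); have := g_le (ltW x0).
  by rewrite -/M; lra.
rewrite (@le_trans _ _ (e * (M * (1 + d ^- 2)) * K 1 t))//; last first.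
  by rewrite lerDr (mulr_ge0 (ltW eta0) Kt).
pose u := ln t - ln x.
have q0 : 0 < e ^+ 2 + u ^+ 2 by rewrite ltr_wpDr ?sqr_ge0// exprn_gt0.
have q1 : 0 < 1 + u ^+ 2 by rewrite ltr_wpDr ?sqr_ge0.
have du : d ^+ 2 <= u ^+ 2.
  by rewrite -[leRHS]real_normK ?num_real// lerXn2r ?nnegrE// ?(ltW d0)// /u distrC.
have key : (e ^+ 2 + u ^+ 2)^-1 <= (1 + d ^- 2) / (1 + u ^+ 2).
  rewrite -[leLHS]mul1r ler_pdivrMr// mulrAC ler_pdivlMr// mul1r.
  have : 1 <= d ^- 2 * u ^+ 2 by rewrite ler_pdivlMl ?exprn_gt0// mulr1.
  have : 0 <= d ^- 2 * e ^+ 2 by rewrite mulr_ge0 ?invr_ge0 ?exprn_ge0 ?ltW.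
  have : 0 <= e ^+ 2 by rewrite exprn_ge0 ?ltW.
  by rewrite mulrDl mul1r mulrDr; lra.
rewrite (_ : e * _ * _ = M * (e * ((1 + d ^- 2) / (1 + u ^+ 2)) / t)); last first.
  by rewrite /K /log_poisson -/u expr1n div1r !mulrA; ring.
by rewrite ler_wpM2l// ler_wpM2r ?invr_ge0 ?(ltW t0)// ler_wpM2l// ltW.
Qed.

(** The sequence [J (1 / (n + 1))] has two limits: the integral of [h], by dominated convergence
    thanks to the decay of Gamma, and [pi * g x], by the kernel estimate. *)
Lemma gamma_mellin_inversion : Rintegral mu D h = pi * g x.
Proof.
have [Kd Kd0 decay] := GammaC_decay b0.
have mh : measurable_fun setT h.
  apply: continuous_measurable_fun => y.
  have ccos : {for y, continuous (fun y : R => cos (y * ln x))}.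
    apply: (@cvg_comp _ _ _ (fun y : R => y * ln x) (@cos R) _ (nbhs (y * ln x)));
      last exact: continuous_cos.
    by apply: cvgM; [exact: cvg_id|exact: cvg_cst].
  have csin : {for y, continuous (fun y : R => sin (y * ln x))}.
    apply: (@cvg_comp _ _ _ (fun y : R => y * ln x) (@sin R) _ (nbhs (y * ln x)));
      last exact: continuous_sin.
    by apply: cvgM; [exact: cvg_id|exact: cvg_cst].
  apply: cvgD; apply: cvgM => //.
    exact: (continuous_oscillating_gamma b0 (@is_derive_cos R) norm_cos_le1).
  exact: (continuous_oscillating_gamma b0 (@is_derive_sin R) norm_sin_le1).
have h_le y : `|h y| <= (Kd + Kd) / (1 + y ^+ 2).
  have [hc hs] := decay y.
  rewrite (le_trans (ler_normD _ _))// mulrDl lerD// normrM.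
    by rewrite (le_trans _ hc)// ler_piMr// norm_cos_le1.
  by rewrite (le_trans _ hs)// ler_piMr// norm_sin_le1.
have iK : mu.-integrable D (EFin \o (fun y : R => (Kd + Kd) / (1 + y ^+ 2))).
  by apply: integrableS (integrable_inv_oneDsqr (Kd + Kd)).
pose e_ n : R := n.+1%:R^-1.
have e_gt0 n : 0 < e_ n by rewrite invr_gt0.
have me n : measurable_fun setT (fun y => expR (- (e_ n * y)) * h y).
  apply: measurable_funM => //.
  by apply: measurableT_comp => //; apply: measurableT_comp => //; exact: measurable_funM.
have he_le n y : D y -> `|expR (- (e_ n * y)) * h y| <= (Kd + Kd) / (1 + y ^+ 2).
  rewrite /= in_itv/= andbT => y0.
  rewrite normrM (ger0_norm (expR_ge0 _)) (le_trans _ (h_le y))// ler_piMl//.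
  by rewrite -expR0 ler_expR oppr_le0 mulr_ge0// ltW.
have K_ge0 y : 0 <= (Kd + Kd) / (1 + y ^+ 2).
  by rewrite divr_ge0 ?addr_ge0// ?sqr_ge0.
have ih : mu.-integrable D (EFin \o h).
  apply: (le_integrable _ _ _ iK) => //.
    by apply/measurable_EFinP; exact: measurable_funTS.
  by move=> y _; rewrite lee_fin /= (ger0_norm (K_ge0 _)).
have ihe n : mu.-integrable D (EFin \o (fun y => expR (- (e_ n * y)) * h y)).
  apply: (le_integrable _ _ _ iK) => //.
    by apply/measurable_EFinP; exact: (measurable_funTS (me n)).
  by move=> y Dy; rewrite lee_fin /= (ger0_norm (K_ge0 _)) he_le.
have Jh : (J (e_ n))%:E @[n --> \oo] --> (Rintegral mu D h)%:E.
  have JnE n : (J (e_ n))%:E = (\int[mu]_(y in D) (expR (- (e_ n * y)) * h y)%:E)%E.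
    by rewrite /J /Rintegral fineK//; apply: integrable_fin_num => //; exact: ihe.
  under eq_fun do rewrite JnE.
  rewrite /Rintegral fineK ?integrable_fin_num//.
  have [//||||||_ _ //] := @dominated_convergence _ _ _ mu D _
    (fun n => EFin \o (fun y => expR (- (e_ n * y)) * h y)) (EFin \o h)
    (EFin \o (fun y => (Kd + Kd) / (1 + y ^+ 2))).
  - by move=> n; apply/measurable_EFinP; exact: (measurable_funTS (me n)).
  - by apply/measurable_EFinP; exact: measurable_funTS.
  - apply: aeW => y _; apply: cvg_EFin; first exact: nearW.
    rewrite -[X in _ --> X]mul1r; apply: cvgM; last exact: cvg_cst.
    rewrite -expR0 -oppr0 -(mul0r y).
    apply: (@cvg_comp _ _ _ (fun n => - (e_ n * y)) expR _ (nbhs (- (0 * y))));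
      last exact: continuous_expR.
    by apply: cvgN; apply: cvgM; [exact: cvg_harmonic|exact: cvg_cst].
  - exact: iK.
  - by apply: aeW => y n Dy; rewrite lee_fin; exact: he_le.
have Jg : J (e_ n) @[n --> \oo] --> pi * g x.
  apply/cvgrPdist_le => r r0.
  (* With this [eta] the term [eta * pi] takes one half of [r]; the other half is left for
     [e_ n * C]. *)
  have eta0 : 0 < r / 2 / pi by rewrite !divr_gt0// pi_gt0.
  have [C hC] := J_approx eta0.
  have eC : e_ n * C @[n --> \oo] --> (0 : R).
    by rewrite -(mul0r C); apply: cvgM; [exact: cvg_harmonic|exact: cvg_cst].
  move/cvgrPdist_le : eC => /(_ (r / 2)); rewrite divr_gt0// => /(_ isT) near_eC.
  near=> n; rewrite distrC (le_trans (hC _ (e_gt0 n)))//.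
  rewrite divfK ?gt_eqF ?pi_gt0// [leRHS]splitr lerD2l (le_trans (ler_norm _))//.
  by rewrite -normrN -sub0r; near: n.
have Jg' : (J (e_ n))%:E @[n --> \oo] --> (pi * g x)%:E.
  by apply: cvg_EFin; first exact: nearW.
by apply: EFin_inj; exact: (cvg_unique _ Jh Jg').
Unshelve. all: by end_near. Qed.

End MellinInversion.
End Inversion.

(** * The ultra-exponential weights and their moments *)

Section ChangeOfVariables.
Context {R : realType}.
Notation mu := (@lebesgue_measure R).
Notation D := (`]0%R, +oo[%classic : set R).

Lemma Rintegral_even (f : R -> R) : mu.-integrable setT (EFin \o f) ->
  (forall y, f (- y) = f y) -> Rintegral mu setT f = 2 * Rintegral mu D f.
Proof.
move=> intf even_f.
have mf : measurable_fun setT (EFin \o f) by exact: measurable_int intf.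
have iN : mu.-integrable `]-oo, 0%R[ (EFin \o f) by apply: integrableS intf.
have i0 : mu.-integrable `[0%R, +oo[ (EFin \o f) by apply: integrableS intf.
have e : [set: R] = `]-oo, 0%R[ `|` `[0%R, +oo[.
  apply/seteqP; split=> y //= _; rewrite !in_itv/= andbT.
  by have [|] := ltP y 0; [left|right].
rewrite e Rintegral_setU//; last 2 first.
- by rewrite -e.
- apply/disj_setPRL => y /=; rewrite !in_itv/= andbT => y0.
  by move=> /(le_lt_trans y0); rewrite ltxx.
rewrite mulr_natl mulr2n; congr (_ + _); last first.
  rewrite -Rintegral_itv_obnd_cbnd//; apply: integrableS i0 => //.
  by move=> y /=; rewrite !in_itv/= !andbT; exact: ltW.
congr fine.
rewrite (_ : `]-oo, 0%R[%classic = (-%R : _ -> measurableTypeR R) @^-1` D); last first.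
  by apply/seteqP; split=> y /=; rewrite !in_itv/= andbT oppr_gt0.
transitivity (\int[mu]_(y in (-%R : _ -> measurableTypeR R) @^-1` D) ((EFin \o f) \o -%R) y)%E.
  by apply: eq_integral => y _ /=; rewrite even_f.
rewrite -integral_pushforward//.
- by apply: eq_measure_integral => A mA _; exact: lebesgue_measureN.
- rewrite (_ : _ @^-1` D = `]-oo, 0%R[%classic); last first.
    by apply/seteqP; split=> y /=; rewrite !in_itv/= andbT oppr_gt0.
  by apply: eq_integrable iN => // y _ /=; rewrite even_f.
Qed.

Lemma ge0_integral_swap (A B : set (measurableTypeR R)) (f : R -> R -> \bar R) :
  measurable A -> measurable B -> measurable_fun setT (fun z : R * R => f z.1 z.2) ->
  (forall y t, (0 <= f y t)%E) ->
  (\int[mu]_(y in A) \int[mu]_(t in B) f y t = \int[mu]_(t in B) \int[mu]_(y in A) f y t)%E.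
Proof.
move=> mA mB mf f0.
pose F (z : R * R) := (f z.1 z.2 * (\1_A z.1 * \1_B z.2)%:E)%E.
have mF : measurable_fun setT F.
  apply: emeasurable_funM => //; apply/measurable_EFinP; apply: measurable_funM.
    by apply: measurableT_comp => //; exact: measurable_indic.
  by apply: measurableT_comp => //; exact: measurable_indic.
have F0 z : (0 <= F z)%E by rewrite mule_ge0// lee_fin mulr_ge0.
have H := @fubini_tonelli _ _ _ _ _ mu mu F mF F0.
rewrite [RHS]integral_mkcond [LHS]integral_mkcond.
transitivity (\int[mu]_y \int[mu]_t F (y, t))%E.
  apply: eq_integral => y _; rewrite patchE; case: ifPn => yA.
    rewrite integral_mkcond; apply: eq_integral => t _.
    rewrite /F patchE /= !indicE yA mul1r; case: ifPn; rewrite ?mule1 ?mule0//.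
  have -> : (\int[mu]_t F (y, t) = 0)%E; last by [].
  by apply: integral0_eq => t _; rewrite /F/= !indicE (negbTE yA) mul0r mule0.
rewrite H.
apply: eq_integral => t _; rewrite patchE; case: ifPn => tB.
  rewrite [RHS]integral_mkcond; apply: eq_integral => y _.
  by rewrite /F patchE /= !indicE tB mulr1; case: ifPn; rewrite ?mule1 ?mule0.
have -> : (\int[mu]_y F (y, t) = 0)%E; last by [].
by apply: integral0_eq => y _; rewrite /F/= !indicE (negbTE tB) mulr0 mule0.
Qed.

(** Lebesgue measure is [c] times its push-forward under multiplication by [c]; by uniqueness it is
    enough to compare the two on half-open intervals. *)
Lemma ge0_integral_scale (c : R) (f : R -> \bar R) : 0 < c ->
  measurable_fun setT f -> (forall x, (0 <= f x)%E) ->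
  (\int[mu]_(x in D) f x = c%:E * \int[mu]_(x in D) f (c * x)%R)%E.
Proof.
move=> c0 mf f0.
pose phi : R -> measurableTypeR R := fun x => c * x.
have mphi : measurable_fun setT phi by exact: measurable_funM.
(* [mscale] expects a bundled measure, so the set function [pushforward mu phi] is replaced by an
   equal measure [pf]. *)
have [pf pfE] : exists m : {measure set (measurableTypeR R) -> \bar R},
    (m : set (measurableTypeR R) -> \bar R) = pushforward mu phi.
  by unshelve refine (ex_intro _ _ (erefl _)).
have k0 : 0 <= c by exact: ltW.
pose nu := mscale (NngNum k0) pf.
have nuE (A : set (measurableTypeR R)) : measurable A -> mu A = nu A.
  apply: lebesgue_measure_unique => _ [[a b] _ <-].
  rewrite [RHS](_ : _ = c%:E * mu (phi @^-1` `]a, b]%classic))%E; last first.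
    by rewrite -[mu (_ @^-1` _)]/(pushforward mu phi _) -pfE.
  rewrite /= (_ : phi @^-1` _ = `]c^-1 * a, c^-1 * b]%classic); last first.
    by apply/seteqP; split=> y /=; rewrite !in_itv/= ltr_pdivrMl// ler_pdivlMl.
  rewrite !lebesgue_measure_itv/= !lte_fin ltr_pM2l ?invr_gt0//.
  case: ifPn => _; last by rewrite mule0.
  by rewrite -!EFinB -EFinM -mulrBr mulVKf// gt_eqF.
have mfD : measurable_fun D f by exact: measurable_funTS.
transitivity (\int[mscale (NngNum k0) pf]_(x in D) f x)%E.
  by apply: eq_measure_integral => A mA _; exact: nuE.
rewrite ge0_integral_mscale//; congr (_ * _)%E.
transitivity (\int[pushforward mu phi]_(x in D) f x)%E.
  by apply: eq_measure_integral => A _ _; exact: (congr1 (fun m => m A) pfE).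
rewrite ge0_integral_pushforward//.
rewrite (_ : phi @^-1` _ = D)//.
by apply/seteqP; split=> y /=; rewrite !in_itv/= !andbT pmulr_rgt0.
Qed.

End ChangeOfVariables.

(** * The weights as inverse Mellin integrals *)

Section Rho.
Context {R : realType}.
Notation mu := (@lebesgue_measure R).
Notation D := (`]0%R, +oo[%classic : set R).

Notation W := oscillating_gamma.

(** The Mellin transform of [rho nu k] at [s = 1 + i y]: the integrand of [rho] without its power of
    [x]. *)
Definition mellin_factor (nu : R) (k : nat) (y : R) : R * R :=
  cmul (GammaC (nu + 1, y)) (iter k (cmul (GammaC (1, y))) (1, 0)).

Lemma mellin_factor0 (nu y : R) : mellin_factor nu 0 y = GammaC (nu + 1, y).
Proof.
by rewrite /mellin_factor /cmul /= !mulr1 !mulr0 subr0 add0r [RHS]surjective_pairing.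
Qed.

Lemma mellin_factorS (nu : R) (k : nat) (y : R) :
  mellin_factor nu k.+1 y = cmul (mellin_factor nu k y) (GammaC (1, y)).
Proof.
rewrite /mellin_factor iterS; set I := iter _ _ _; case: I => i1 i2.
case: (GammaC (nu + 1, y)) => a1 a2; case: (GammaC (1, y)) => c1 c2.
by rewrite /cmul/=; congr (_, _); ring.
Qed.

(** The factor [Gamma (nu + s)] alone supplies the decay; each further [Gamma s] is bounded by
    [Gamma 1]. *)
Lemma mellin_factor_bound (nu : R) (k : nat) : 0 <= nu ->
  exists2 K : R, 0 <= K & forall y : R,
    `|(mellin_factor nu k y).1| <= K / (1 + y ^+ 2) /\
    `|(mellin_factor nu k y).2| <= K / (1 + y ^+ 2).
Proof.
move=> nu0; elim: k => [|k [K K0 hK]].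
  have [K K0 hK] := @GammaC_decay R (nu + 1) (ltr_wpDl nu0 ltr01).
  by exists K => // y; rewrite mellin_factor0; exact: hK.
pose G := GammaR (1 : R); have G0 : 0 <= G by exact/ltW/GammaR_gt0.
exists (K * G + K * G); first by rewrite addr_ge0// mulr_ge0.
move=> y; have [h1 h2] := hK y.
have hc : `|(GammaC (1, y)).1| <= G.
  exact: (oscillating_gamma_le _ ltr01 (@is_derive_cos R) norm_cos_le1).
have hs : `|(GammaC (1, y)).2| <= G.
  exact: (oscillating_gamma_le _ ltr01 (@is_derive_sin R) norm_sin_le1).
rewrite mellin_factorS /=.
have e : (K * G + K * G) / (1 + y ^+ 2) = K / (1 + y ^+ 2) * G + K / (1 + y ^+ 2) * G by ring.
rewrite e; split.
  by rewrite (le_trans (ler_normB _ _))// lerD// normrM ler_pM.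
by rewrite (le_trans (ler_normD _ _))// lerD// normrM ler_pM.
Qed.

Lemma measurable_mellin_factor (nu : R) (k : nat) : 0 <= nu ->
  measurable_fun setT (fun y => (mellin_factor nu k y).1) /\
  measurable_fun setT (fun y => (mellin_factor nu k y).2).
Proof.
move=> nu0.
have mc (a : R) : 0 < a -> measurable_fun setT (fun y => (GammaC (a, y)).1).
  move=> a0; apply: continuous_measurable_fun.
  exact: (continuous_oscillating_gamma a0 (@is_derive_cos R) norm_cos_le1).
have ms (a : R) : 0 < a -> measurable_fun setT (fun y => (GammaC (a, y)).2).
  move=> a0; apply: continuous_measurable_fun.
  exact: (continuous_oscillating_gamma a0 (@is_derive_sin R) norm_sin_le1).
elim: k => [|k [m1 m2]].
  under eq_fun do rewrite mellin_factor0.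
  under [X in _ /\ measurable_fun _ X]eq_fun do rewrite mellin_factor0.
  by split; [apply: mc|apply: ms]; exact: ltr_wpDl.
have e1 : (fun y => (mellin_factor nu k.+1 y).1) = (fun y =>
    (mellin_factor nu k y).1 * (GammaC (1, y)).1 - (mellin_factor nu k y).2 * (GammaC (1, y)).2).
  by apply/funext => y; rewrite mellin_factorS.
have e2 : (fun y => (mellin_factor nu k.+1 y).2) = (fun y =>
    (mellin_factor nu k y).1 * (GammaC (1, y)).2 + (mellin_factor nu k y).2 * (GammaC (1, y)).1).
  by apply/funext => y; rewrite mellin_factorS.
have mc1 := mc 1 ltr01; have ms1 := ms 1 ltr01.
rewrite e1 e2; split.
  by apply: measurable_funB; apply: measurable_funM.
by apply: measurable_funD; apply: measurable_funM.
Qed.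

(** The real part of [mellin_factor nu k y * exp (- i y u)]; with [u = ln x] it is the integrand of
    [rho] up to the modulus [1 / x] of [x ^ (- s)]. *)
Definition mellin_integrand (nu : R) (k : nat) (u y : R) : R :=
  (mellin_factor nu k y).1 * cos (y * u) + (mellin_factor nu k y).2 * sin (y * u).

Lemma rho_mellin_integrand (nu : R) (k : nat) (x : R) : 0 < x ->
  rho nu k x = (2 * pi)^-1 * Rintegral mu setT (fun y => x^-1 * mellin_integrand nu k (ln x) y).
Proof.
move=> x0; rewrite /rho; congr (_ * _); apply: eq_Rintegral => y _.
rewrite -[rho_integrand nu k x y]/(cmul (mellin_factor nu k y) (cpow_neg x (1, y))).
rewrite /mellin_integrand /cpow_neg; case: (mellin_factor nu k y) => a1 a2.
by rewrite /cmul/= powR_inv1 ?(ltW x0)//; ring.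
Qed.

Lemma mellin_integrand_bound (nu : R) (k : nat) : 0 <= nu ->
  exists2 K : R, 0 <= K & forall u y : R, `|mellin_integrand nu k u y| <= K / (1 + y ^+ 2).
Proof.
move=> nu0; have [K K0 hK] := mellin_factor_bound k nu0.
exists (K + K); first by rewrite addr_ge0.
move=> u y; have [h1 h2] := hK y.
rewrite (le_trans (ler_normD _ _))// [leRHS]mulrDl lerD// normrM.
  by rewrite (le_trans _ h1)// ler_piMr// norm_cos_le1.
by rewrite (le_trans _ h2)// ler_piMr// norm_sin_le1.
Qed.

Lemma measurable_mellin_integrand (nu : R) (k : nat) (v : R -> R) : 0 <= nu ->
  measurable_fun setT v ->
  measurable_fun setT (fun z : R * R => mellin_integrand nu k (v z.2) z.1).
Proof.
move=> nu0 mv; have [m1 m2] := measurable_mellin_factor k nu0.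
have mph : measurable_fun setT (fun z : R * R => z.1 * v z.2).
  by apply: measurable_funM => //; exact: measurableT_comp.
apply: measurable_funD; apply: measurable_funM.
- exact: (measurableT_comp m1).
- apply: measurableT_comp mph; apply: continuous_measurable_fun; exact: continuous_cos.
- exact: (measurableT_comp m2).
- apply: measurableT_comp mph; apply: continuous_measurable_fun; exact: continuous_sin.
Qed.

Lemma integrable_mellin_integrand (nu : R) (k : nat) (u : R) : 0 <= nu ->
  mu.-integrable setT (EFin \o mellin_integrand nu k u).
Proof.
move=> nu0; have [K K0 hK] := mellin_integrand_bound k nu0.
apply: (le_integrable _ _ _ (integrable_inv_oneDsqr K)) => //.
  apply/measurable_EFinP.
  have m := @measurable_mellin_integrand nu k (fun=> u) nu0 (measurable_cst u).
  exact: (measurableT_comp m (pair2_measurable (0 : R))).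
by move=> y _; rewrite lee_fin /= (le_trans (hK u y))// ler_norm.
Qed.

Lemma rhoE (nu : R) (k : nat) (x : R) : 0 <= nu -> 0 < x ->
  rho nu k x = (2 * pi)^-1 / x * Rintegral mu setT (mellin_integrand nu k (ln x)).
Proof.
move=> nu0 x0; rewrite rho_mellin_integrand// RintegralZl ?mulrA//.
exact: integrable_mellin_integrand.
Qed.

(** Inversion is applied with [b = nu + 1], the abscissa of [nu + s] on the line [Re s = 1]; the
    factor [1 / x] brings [x ^ (nu + 1)] back to [x ^ nu]. As Gamma commutes with conjugation, the
    integrand is even in [y], and the half-line formula is enough. *)
Lemma rho0 (nu x : R) : 0 <= nu -> 0 < x -> rho nu 0 x = x `^ nu * expR (- x).
Proof.
move=> nu0 x0; have b0 : 0 < nu + 1 by exact: ltr_wpDl.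
rewrite rhoE// Rintegral_even; last 2 first.
- exact: integrable_mellin_integrand.
- move=> y; rewrite /mellin_integrand !mellin_factor0.
  rewrite !GammaC_cosE !GammaC_sinE !mulNr cosN sinN mulrN.
  have -> : W cos (nu + 1) (- y) = W cos (nu + 1) y.
    by apply: eq_Rintegral => t _; rewrite mulNr cosN.
  suff -> : W sin (nu + 1) (- y) = - W sin (nu + 1) y by rewrite mulNr opprK.
  rewrite -(oscillating_gammaN _ b0 (@is_derive_sin R) norm_sin_le1).
  by apply: eq_Rintegral => t _; rewrite mulNr sinN.
have -> : Rintegral mu D (mellin_integrand nu 0 (ln x)) = pi * (x `^ (nu + 1) * expR (- x)).
  rewrite -(gamma_mellin_inversion b0 x0); apply: eq_Rintegral => y _.
  by rewrite /mellin_integrand mellin_factor0.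
rewrite powRD ?(gt_eqF x0) ?implybT// powRr1 ?(ltW x0)//.
have p0 : (pi : R) != 0 by exact: lt0r_neq0 (pi_gt0 R).
by move: (pi : R) p0 => p p0; field; rewrite p0 (gt_eqF x0).
Qed.

Lemma rho_bound (nu : R) (k : nat) : 0 <= nu ->
  exists2 B : R, 0 <= B & forall x, 0 < x -> `|rho nu k x| <= B / x.
Proof.
move=> nu0; have [K K0 hK] := mellin_integrand_bound k nu0.
pose I := Rintegral mu setT (fun y : R => K / (1 + y ^+ 2)).
have pi2 : 0 <= (2 * pi : R)^-1 by rewrite invr_ge0 mulr_ge0// pi_ge0.
exists ((2 * pi)^-1 * I).
  by rewrite mulr_ge0// Rintegral_ge0// => y _; rewrite divr_ge0// addr_ge0// sqr_ge0.
move=> x x0; rewrite rhoE// normrM ger0_norm; last by rewrite divr_ge0// ltW.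
rewrite mulrAC ler_wpM2r ?invr_ge0 ?(ltW x0)// ler_wpM2l//.
have im := integrable_mellin_integrand k (ln x) nu0.
rewrite (le_trans (le_normr_Rintegral _ im))//.
apply: le_Rintegral => //; first exact: integrable_norm.
exact: integrable_inv_oneDsqr.
Qed.

Lemma rhoS_swap (nu : R) (k : nat) (x : R) : 0 <= nu -> 0 < x ->
  rho nu k.+1 x = Rintegral mu D (fun t => t^-1 * expR (- t) * rho nu k (x / t)).
Proof.
move=> nu0 x0; have [K K0 hK] := mellin_integrand_bound k nu0.
have i1 := @integrable_GammaR R 1 ltr01.
have ie : mu.-integrable D (EFin \o (fun t : R => expR (- t))).
  by apply: eq_integrable i1 => // t _; rewrite /= subrr powRr0 mul1r.
have me (c : R -> R) (y : R) : (forall u : R, `|c u| <= 1) -> measurable_fun setT c ->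
    mu.-integrable D (EFin \o (fun t => expR (- t) * c (y * ln t))).
  move=> c1 mc; apply: (le_integrable _ _ _ ie) => //.
    apply/measurable_EFinP; apply: measurable_funTS; apply: measurable_funM.
      exact: measurableT_comp.
    apply: (measurableT_comp mc); apply: measurable_funM => //; exact: measurable_ln.
  by move=> t _; rewrite lee_fin /= normrM ler_piMr.
have WE (c : R -> R) (y : R) : W c 1 y = Rintegral mu D (fun t => expR (- t) * c (y * ln t)).
  by apply: eq_Rintegral => t _; rewrite subrr powRr0 mul1r mulrC.
(* Multiplying by [Gamma (1 + i y)], the integral of [exp (- t) t ^ (i y)], shifts the phase from
   [ln x] to [ln x - ln t] under the integral over [t]. *)
have step (y : R) : mellin_integrand nu k.+1 (ln x) y =
    Rintegral mu D (fun t => expR (- t) * mellin_integrand nu k (ln x - ln t) y).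
  have ic := me _ y norm_cos_le1 (continuous_measurable_fun (@continuous_cos R)).
  have isn := me _ y norm_sin_le1 (continuous_measurable_fun (@continuous_sin R)).
  have GE : GammaC (1, y) = (W cos 1 y, W sin 1 y) by [].
  rewrite /mellin_integrand mellin_factorS GE; case: (mellin_factor nu k y) => a1 a2 /=.
  pose p := a1 * cos (y * ln x) + a2 * sin (y * ln x).
  pose q := a1 * sin (y * ln x) - a2 * cos (y * ln x).
  transitivity (p * W cos 1 y + q * W sin 1 y); first by rewrite /p /q; ring.
  rewrite !WE -!RintegralZl// -RintegralD//; last 2 first.
  - exact: (integrableZl _ p ic).
  - exact: (integrableZl _ q isn).
  by apply: eq_Rintegral => t _; rewrite mulrBr cosB sinB /p /q; ring.
pose c := (2 * pi)^-1 / x.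
rewrite rhoE// -RintegralZl//; last exact: integrable_mellin_integrand.
transitivity (Rintegral mu setT (fun y => Rintegral mu D (fun t =>
    c * expR (- t) * mellin_integrand nu k (ln x - ln t) y))).
  apply: eq_Rintegral => y _; rewrite -[X in _ * X = _]/(mellin_integrand nu k.+1 (ln x) y)
    step -RintegralZl//.
    by apply: eq_Rintegral => t _; rewrite mulrA.
  have m := @measurable_mellin_integrand nu k (fun t => ln x - ln t) nu0
    (measurable_funB (measurable_cst _) (@measurable_ln R)).
  apply: (le_integrable _ _ _ (integrableZl _ (K / (1 + y ^+ 2)) ie)) => //.
    apply/measurable_EFinP; apply: measurable_funTS; apply: measurable_funM.
      exact: measurableT_comp.
    exact: (measurableT_comp m (pair1_measurable y)).
  move=> t _; rewrite lee_fin /= normrM (ger0_norm (expR_ge0 _)) mulrC.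
  by rewrite (le_trans _ (ler_norm _))// ler_wpM2r ?expR_ge0.
(* The bound [K / (1 + y ^ 2)] is uniform in the phase, so the double integral is dominated by a
   product. *)
have ce : mu.-integrable D (EFin \o (fun t : R => `|c| * expR (- t))).
  exact: (integrableZl _ `|c| ie).
rewrite (@Rintegral_swap _ setT D
  (fun y t => c * expR (- t) * mellin_integrand nu k (ln x - ln t) y)
  (fun y => K / (1 + y ^+ 2)) (fun t => `|c| * expR (- t)))//.
- apply: eq_Rintegral => t; rewrite inE/= in_itv/= andbT => t0.
  rewrite RintegralZl//; last exact: integrable_mellin_integrand.
  (* The prefactor of [rho nu k (x / t)] contains [1 / (x / t) = t / x]; the factor [t^-1] of the
     statement compensates the extra [t]. *)
  rewrite rhoE ?divr_gt0// ln_div ?posrE// /c.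
  have p0 : (pi : R) != 0 by exact: lt0r_neq0 (pi_gt0 R).
  move: (Rintegral _ _ _) => I.
  by move: (pi : R) p0 => p p0; field; rewrite p0 (gt_eqF x0) (gt_eqF t0).
- apply: measurable_funM.
    apply: measurable_funM => //.
    by apply: measurableT_comp => //; apply: measurableT_comp.
  apply: (@measurable_mellin_integrand nu k (fun t => ln x - ln t)) => //.
  by apply: measurable_funB => //; exact: measurable_ln.
- exact: integrable_inv_oneDsqr.
- move=> y t _ _; rewrite normrM mulrC normrM (ger0_norm (expR_ge0 _)).
  by rewrite ler_wpM2r// mulr_ge0// expR_ge0.
Qed.

End Rho.

(** * The weights as iterated positive integrals, and their moments *)

Section RhoMoments.
Context {R : realType}.
Notation mu := (@lebesgue_measure R).
Notation D := (`]0%R, +oo[%classic : set R).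

(* Taking values in [\bar R] lets Tonelli be used before finiteness is known; the weight
   [t `^ (-1)] is nonnegative for all [t], unlike [t^-1]. *)
Fixpoint rho_rec (nu : R) (k : nat) (x : R) : \bar R :=
  if k is k'.+1 then
    (\int[mu]_(t in D) ((t `^ (-1) * expR (- t))%:E * rho_rec nu k' (x * t `^ (-1))%R))%E
  else (x `^ nu * expR (- x))%:E.

Lemma rho_rec_ge0 (nu : R) (k : nat) (x : R) : (0 <= rho_rec nu k x)%E.
Proof.
elim: k x => [|k IHk] x /=; first by rewrite lee_fin mulr_ge0 ?powR_ge0 ?expR_ge0.
by apply: integral_ge0 => t _; rewrite mule_ge0// lee_fin mulr_ge0 ?powR_ge0 ?expR_ge0.
Qed.

Let mexpN : measurable_fun setT (fun t : R => expR (- t)).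
Proof. exact: measurableT_comp. Qed.

Let mweight : measurable_fun setT (fun t : R => (t `^ (-1) * expR (- t))%:E).
Proof. by apply/measurable_EFinP; apply: measurable_funM => //; exact: measurable_powR. Qed.

Let mquot : measurable_fun setT (fun z : R * R => z.1 * z.2 `^ (-1)).
Proof. by apply: measurable_funM => //; exact: (measurableT_comp (@measurable_powR R (-1))). Qed.

Lemma measurable_rho_rec (nu : R) (k : nat) : measurable_fun setT (rho_rec nu k).
Proof.
elim: k => [|k IHk] /=.
  by apply/measurable_EFinP; apply: measurable_funM => //; exact: measurable_powR.
pose F (z : R * R) := ((z.2 `^ (-1) * expR (- z.2))%:E * rho_rec nu k (z.1 * z.2 `^ (-1))%R *
  (\1_D z.2)%:E)%E.
have mF : measurable_fun setT F.
  apply: emeasurable_funM.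
    by apply: emeasurable_funM; [exact: (measurableT_comp mweight)|exact: (measurableT_comp IHk
      mquot)].
  apply/measurable_EFinP; apply: measurableT_comp => //; exact: measurable_indic.
have F0 z : (0 <= F z)%E.
  by rewrite !mule_ge0 ?rho_rec_ge0// lee_fin// mulr_ge0 ?powR_ge0 ?expR_ge0.
have := measurable_fun_fubini_tonelli_F (m2 := mu) F mF F0.
rewrite (_ : fubini_F _ _ = fun x : R => (\int[mu]_(t in D)
  ((t `^ (-1) * expR (- t))%:E * rho_rec nu k (x * t `^ (-1))%R))%E)//.
apply/funext => x; rewrite [RHS]integral_mkcond; apply: eq_integral => t _.
by rewrite /F patchE /= indicE; case: ifPn => _; rewrite ?mule1 ?mule0.
Qed.

(** The recursion stays finite because [rho_bound] gives [t^-1 exp (- t) B / (x / t) = (B / x) exp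
    (- t)], integrable in [t]. The extended integral then agrees with the real one in
    [rhoS_swap]. *)
Lemma rho_recE (nu : R) (k : nat) (x : R) : 0 <= nu -> 0 < x ->
  rho_rec nu k x = (rho nu k x)%:E.
Proof.
move=> nu0; elim: k x => [|k IHk] x x0 /=; first by rewrite rho0.
have [B B0 hB] := rho_bound k nu0.
pose f t := t^-1 * expR (- t) * rho nu k (x / t).
have ef (t : R) : t \in D -> ((t `^ (-1) * expR (- t))%:E * rho_rec nu k (x * t `^ (-1))%R)%E =
  (f t)%:E.
  rewrite inE/= in_itv/= andbT => t0.
  by rewrite powR_inv1 ?(ltW t0)// IHk ?divr_gt0// -EFinM.
transitivity (\int[mu]_(t in D) (f t)%:E)%E; first exact: eq_integral.
rewrite rhoS_swap// /Rintegral fineK//.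
apply: integrable_fin_num => //.
have i1 := integrableZl _ (B / x) (@integrable_GammaR R 1 ltr01).
apply: (le_integrable _ _ _ (i1 _)) => //.
  apply: (eq_measurable_fun _ ef); apply: measurable_funTS.
  apply: emeasurable_funM => //.
  exact: (measurableT_comp (@measurable_rho_rec nu k) (measurableT_comp mquot (pair1_measurable
    x))).
move=> t; rewrite /= in_itv/= andbT => t0.
have w0 : 0 <= t^-1 * expR (- t) by rewrite mulr_ge0 ?expR_ge0// invr_ge0 ltW.
rewrite lee_fin /= subrr powRr0 mul1r (le_trans _ (ler_norm _))//.
have -> : B / x * expR (- t) = t^-1 * expR (- t) * (B / (x / t)).
  by field; rewrite (gt_eqF x0) (gt_eqF t0).
by rewrite normrM (ger0_norm w0) ler_wpM2l// hB// divr_gt0.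
Qed.

(** After Tonelli, the scaling [x -> t x] turns [x * t^-1] into [x]. The Jacobian [t] cancels the
    weight [t^-1], and [x ^ (a - 1)] releases [t ^ (a - 1)], so the integral over [t] is Euler's
    integral for [GammaR a]. *)
Lemma rho_rec_moment (nu : R) (k : nat) (a : R) : 0 <= nu -> 0 < a ->
  (\int[mu]_(x in D) (rho_rec nu k x * (x `^ (a - 1))%:E) =
    (GammaR (nu + a) * GammaR a ^+ k)%:E)%E.
Proof.
move=> nu0 a0; elim: k => [|k IHk] /=.
  have na0 : 0 < nu + a by exact: ltr_wpDl.
  rewrite expr0 mulr1 GammaR_integral /Rintegral fineK; last first.
    by apply: integrable_fin_num => //; exact: integrable_GammaR.
  apply: eq_integral => x; rewrite inE/= in_itv/= andbT => x0.
  rewrite -EFinM; congr EFin.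
  by rewrite mulrAC -powRD ?addrA// (gt_eqF x0) implybT.
pose r := rho_rec nu k; pose w (t : R) : \bar R := (t `^ (-1) * expR (- t))%:E.
have w0 t : (0 <= w t)%E by rewrite lee_fin mulr_ge0 ?powR_ge0 ?expR_ge0.
have r0 x : (0 <= r x)%E by exact: rho_rec_ge0.
have p0 (x : R) : (0 <= (x `^ (a - 1))%:E)%E by rewrite lee_fin powR_ge0.
have mp : measurable_fun setT (fun x : R => (x `^ (a - 1))%:E).
  by apply/measurable_EFinP; exact: measurable_powR.
have mr := @measurable_rho_rec nu k.
transitivity (\int[mu]_(x in D) \int[mu]_(t in D) (w t * r (x * t `^ (-1))%R * (x `^ (a -
  1))%:E))%E.
  apply: eq_integral => x _; rewrite ge0_integralZr//.
  - apply: measurable_funTS; apply: emeasurable_funM => //.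
    exact: (measurableT_comp mr (measurableT_comp mquot (pair1_measurable x))).
  - by move=> t _; rewrite mule_ge0.
rewrite (@ge0_integral_swap _ D D (fun x t => w t * r (x * t `^ (-1))%R * (x `^ (a -
  1))%:E)%E)//; last 2 first.
- apply: emeasurable_funM; last exact: (measurableT_comp mp).
  by apply: emeasurable_funM; [exact: (measurableT_comp mweight)|exact: (measurableT_comp mr
    mquot)].
- by move=> x t; rewrite !mule_ge0.
transitivity (\int[mu]_(t in D) ((GammaR (nu + a) * GammaR a ^+ k)%:E * (t `^ (a - 1) * expR (-
  t))%:E))%E.
  apply: eq_integral => t; rewrite inE/= in_itv/= andbT => t0.
  have mrt : measurable_fun setT (fun x : R => r (x * t `^ (-1))%R).
    exact: (measurableT_comp mr (measurableT_comp mquot (pair2_measurable t))).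
  under eq_integral do rewrite -muleA.
  rewrite ge0_integralZl//; last 2 first.
  - by apply: measurable_funTS; apply: emeasurable_funM.
  - by move=> x _; rewrite mule_ge0.
  rewrite (@ge0_integral_scale _ t)//; last 2 first.
  - exact: emeasurable_funM.
  - by move=> x; rewrite mule_ge0.
  rewrite (_ : (\int[mu]_(x in D) _)%E = ((t `^ (a - 1))%:E * (GammaR (nu + a) * GammaR a ^+
    k)%:E)%E); last first.
    rewrite -IHk -ge0_integralZl//; last 2 first.
    - by apply: measurable_funTS; apply: emeasurable_funM.
    - by move=> x _; rewrite mule_ge0.
    apply: eq_integral => x; rewrite inE/= in_itv/= andbT => x0.
    rewrite powR_inv1 ?(ltW t0)//.
    have -> : t * x / t = x by rewrite mulrAC mulfV ?mul1r// gt_eqF.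
    rewrite powRM ?(ltW x0) ?(ltW t0)//.
    by rewrite EFinM muleCA.
  rewrite /w -!EFinM powR_inv1 ?(ltW t0)//; congr EFin.
  move: (GammaR _) => g1; move: (GammaR _ ^+ _) => g2.
  by field; rewrite gt_eqF.
have i1 := integrable_GammaR a0.
rewrite integralZl// exprS; have -> : (\int[mu]_(t in D) (t `^ (a - 1) * expR (- t))%:E)%E =
  (GammaR a)%:E.
  by rewrite GammaR_integral /Rintegral fineK//; exact: integrable_fin_num.
by rewrite -EFinM; congr EFin; ring.
Qed.

Lemma rho_moment (nu : R) (k : nat) (a : R) : 0 <= nu -> 0 < a ->
  mu.-integrable D (EFin \o (fun x => rho nu k x * x `^ (a - 1))) /\
  (\int[mu]_(x in D) (rho nu k x * x `^ (a - 1))%:E = (GammaR (nu + a) * GammaR a ^+ k)%:E)%E.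
Proof.
move=> nu0 a0; pose f x := (rho_rec nu k x * (x `^ (a - 1))%:E)%E.
have ef (x : R) : x \in D -> f x = (rho nu k x * x `^ (a - 1))%:E.
  by rewrite inE/= in_itv/= andbT => x0; rewrite /f rho_recE.
have e : (\int[mu]_(x in D) f x = (GammaR (nu + a) * GammaR a ^+ k)%:E)%E.
  exact: rho_rec_moment.
split; last by rewrite -e; apply: eq_integral => x Dx; rewrite ef.
have intf : mu.-integrable D f.
  apply/integrableP; split.
    apply: measurable_funTS; apply: emeasurable_funM; first exact: measurable_rho_rec.
    by apply/measurable_EFinP; exact: measurable_powR.
  under eq_integral => x _ do rewrite gee0_abs ?mule_ge0 ?rho_rec_ge0 ?lee_fin ?powR_ge0//.
  by rewrite e ltry.
by apply: eq_integrable intf => // x Dx; rewrite ef.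
Qed.

End RhoMoments.

(** * The operator theta on polynomials *)

Section Theta.
Context {R : realType}.
Notation mu := (@lebesgue_measure R).
Notation D := (`]0%R, +oo[%classic : set R).

(** The derivative is local and the half line is open. This permits rewriting under iterated theta
    with formulas for real powers that are available only for [t > 0]. *)
Lemma theta_eq_pos (f g : R -> R) : (forall t, 0 < t -> f t = g t) ->
  forall t, 0 < t -> theta f t = theta g t.
Proof.
move=> fg t t0; rewrite /theta !derive1E; congr (_ * _).
apply: near_eq_derive.
near=> u; rewrite fg//; near: u; exact: lt_nbhsr.
Unshelve. all: by end_near. Qed.

Lemma iter_theta_eq_pos (f g : R -> R) (j : nat) : (forall t, 0 < t -> f t = g t) ->
  forall t, 0 < t -> iter j (@theta R) f t = iter j (@theta R) g t.
Proof. by move=> fg; elim: j => [//|j IHj] /=; exact: theta_eq_pos. Qed.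

Lemma polyop_eq_pos (q : {poly R}) (f g : R -> R) : (forall t, 0 < t -> f t = g t) ->
  forall t, 0 < t -> polyop q f t = polyop q g t.
Proof.
by move=> fg t t0; apply: eq_bigr => j _; rewrite (iter_theta_eq_pos j fg t0).
Qed.

Section Pochhammer.
Variable a : R.

(** Theta conjugated by [t ^ a], acting on the polynomial factor of [t ^ a p(t)]. *)
Definition poly_theta (p : {poly R}) : {poly R} := 'X * ((a + 1) *: p + 'X * p^`()).

Definition pochhammer (i : nat) : R := \prod_(j < i) (1 + a + j%:R).

(** The polynomial [r] for which [p(theta) t ^ a = t ^ a r(t)]: it scales the coefficient of degree
    [i] by the rising factorial [(1 + a)_i]. *)
Definition poly_pochhammer (p : {poly R}) : {poly R} :=
  \poly_(i < size p) (p`_i * pochhammer i).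

Lemma coef_poly_pochhammer (p : {poly R}) (i : nat) :
  (poly_pochhammer p)`_i = p`_i * pochhammer i.
Proof.
by rewrite coef_poly; case: ltnP => // ip; rewrite nth_default// mul0r.
Qed.

Lemma poly_pochhammer1 : poly_pochhammer 1 = 1.
Proof.
apply/polyP => i; rewrite coef_poly_pochhammer coef1.
by case: i => [|i]; rewrite ?mul0r// /pochhammer big_ord0 mulr1.
Qed.

(** Coefficientwise this is [(1 + a)_(i+1) = (1 + a + i) (1 + a)_i]. Through [poly_pochhammer],
    theta becomes multiplication by ['X]. *)
Lemma poly_theta_pochhammer (p : {poly R}) :
  poly_theta (poly_pochhammer p) = poly_pochhammer ('X * p).
Proof.
apply/polyP => i; rewrite coef_poly_pochhammer /poly_theta !coefXM.
case: i => [|i]; rewrite ?mul0r//= coefD coefZ coefXM coef_poly_pochhammer.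
rewrite [in RHS]/pochhammer big_ord_recr/= -/(pochhammer i).
case: i => [|i]; first by rewrite addr0 /=; ring.
rewrite /= coef_deriv coef_poly_pochhammer -mulr_natr; ring.
Qed.

Lemma iter_poly_theta_pochhammer (p : {poly R}) (j : nat) :
  iter j poly_theta (poly_pochhammer p) = poly_pochhammer ('X^j * p).
Proof.
elim: j => [|j IHj] /=; first by rewrite expr0 mul1r.
by rewrite IHj poly_theta_pochhammer exprS mulrA.
Qed.

Lemma theta_powR_horner (p : {poly R}) (t : R) : 0 < t ->
  theta (fun u => u `^ a * p.[u]) t = t `^ a * (poly_theta p).[t].
Proof.
move=> t0; rewrite /theta derive1E.
have dp : is_derive t 1 (horner p) p^`().[t] by exact: is_derive_poly.
have [_ ->] := is_deriveM_fun (is_derive_id t 1) (is_deriveM_fun (is_derive_powR a t0) dp).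
rewrite /poly_theta !hornerE.
have -> : t `^ a = t * t `^ (a - 1).
  by rewrite -{2}[t]powRr1 ?(ltW t0)// -powRD ?(gt_eqF t0) ?implybT//; congr (_ `^ _); ring.
by rewrite /=; ring.
Qed.

Lemma iter_theta_powR_horner (p : {poly R}) (j : nat) (t : R) : 0 < t ->
  iter j (@theta R) (fun u => u `^ a * p.[u]) t = t `^ a * (iter j poly_theta p).[t].
Proof.
elim: j t => [//|j IHj] t t0 /=.
by rewrite (theta_eq_pos IHj)// theta_powR_horner.
Qed.

Lemma polyop_powR_pochhammer (q p : {poly R}) (t : R) : 0 < t ->
  polyop q (fun u => u `^ a * (poly_pochhammer p).[u]) t =
  t `^ a * (poly_pochhammer (q * p)).[t].
Proof.
move=> t0; rewrite /polyop.
have -> : poly_pochhammer (q * p) = \sum_(j < size q) q`_j *: poly_pochhammer ('X^j * p).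
  apply/polyP => i; rewrite coef_poly_pochhammer coef_sum.
  rewrite -{1}[q]coefK poly_def mulr_suml coef_sum mulr_suml.
  by apply: eq_bigr => j _; rewrite coefZ coef_poly_pochhammer -scalerAl coefZ mulrA.
rewrite horner_sum mulr_sumr; apply: eq_bigr => j _.
by rewrite iter_theta_powR_horner// iter_poly_theta_pochhammer hornerZ mulrCA.
Qed.

(** Since [t ^ a] is [t ^ a] times [poly_pochhammer 1], each operator in turn multiplies the
    argument of [poly_pochhammer] by its own polynomial. *)
Lemma polyop_polyop_powR (q p : {poly R}) (t : R) : 0 < t ->
  polyop q (polyop p (fun u => u `^ a)) t = t `^ a * (poly_pochhammer (q * p)).[t].
Proof.
move=> t0; rewrite -polyop_powR_pochhammer//; apply: polyop_eq_pos t0 => {}t t0.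
rewrite -[p in RHS]mulr1 -polyop_powR_pochhammer//; apply: polyop_eq_pos t0 => {}t t0.
by rewrite poly_pochhammer1 hornerC mulr1.
Qed.

End Pochhammer.

Lemma GammaR_pochhammer (a : R) (i : nat) : -1 < a ->
  GammaR (1 + a + i%:R) = pochhammer a i * GammaR (1 + a).
Proof.
move=> a1; have a0 : 0 < 1 + a by rewrite -ltrBlDl sub0r.
elim: i => [|i IHi]; first by rewrite addr0 /pochhammer big_ord0 mul1r.
have -> : 1 + a + i.+1%:R = (1 + a + i%:R) + 1 by rewrite -natr1 addrA.
rewrite GammaRS; last by rewrite ltr_wpDr.
by rewrite IHi /pochhammer big_ord_recr/=; ring.
Qed.

(** A free bound [N] lets [p] and [poly_pochhammer a p] be summed over the same indices without
    comparing their sizes. *)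
Lemma integral_rho_powR_horner (nu a : R) (k N : nat) (p : {poly R}) : 0 <= nu -> -1 < a ->
  (size p <= N)%N ->
  (\int[mu]_(x in D) (rho nu k x * (x `^ a * p.[x]))%:E =
   (\sum_(i < N) p`_i * (GammaR (nu + (1 + a + i%:R)) * GammaR (1 + a + i%:R) ^+ k))%:E)%E.
Proof.
move=> nu0 a1 pN; have ai0 (i : nat) : 0 < 1 + a + i%:R.
  by rewrite ltr_wpDr// -ltrBlDl sub0r.
pose f (i : nat) (x : R) := ((p`_i)%:E * (rho nu k x * x `^ (1 + a + i%:R - 1))%:E)%E.
transitivity (\int[mu]_(x in D) (\sum_(i < N) f i x))%E.
  apply: eq_integral => x; rewrite inE/= in_itv/= andbT => x0.
  rewrite /f; under eq_bigr do rewrite -EFinM; rewrite sumEFin; congr EFin.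
  rewrite (horner_coef_wide _ pN) !mulr_sumr; apply: eq_bigr => i _.
  rewrite (_ : 1 + a + i%:R - 1 = a + i%:R); last by ring.
  by rewrite powRD ?(gt_eqF x0) ?implybT// powR_mulrn ?(ltW x0)//; ring.
have mom i := @rho_moment R nu k (1 + a + i%:R) nu0 (ai0 i).
rewrite integral_sum//; last by move=> i; exact: (integrableZl _ p`_i (mom i).1).
rewrite -sumEFin; apply: eq_bigr => i _.
by rewrite integralZl//; [rewrite (mom i).2 -EFinM|exact: (mom i).1].
Qed.

End Theta.

Theorem theorem4 (R : realType) (k : nat) (nu alpha : R) (Q : nat -> {poly R}) :
  (0 < k)%N -> 0 <= nu -> -1 < alpha ->
  ((forall m n : nat,
      (\int[lebesgue_measure]_(x in `]0%R, +oo[)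
         ((Q n).[x] * (Q m).[x] * rho nu k x * x `^ alpha)%:E)%E
      = ((m == n)%:R)%:E)
   <->
   (forall m n : nat,
      (\int[lebesgue_measure]_(t in `]0%R, +oo[)
         (rho nu k.-1 t * polyop (Q n) (polyop (Q m) (fun u => u `^ alpha)) t)%:E)%E
      = ((m == n)%:R / GammaR (1 + alpha))%:E)).
Proof.
case: k => // k _ nu0 a1 /=.
have G0 : GammaR (1 + alpha) != 0 by rewrite gt_eqF// GammaR_gt0// -ltrBlDl sub0r.
(* The functional integrating [x ^ alpha p(x)] against [rho nu k.+1], written through moments; both
   integrals are expressed by it. *)
pose L (p : {poly R}) := \sum_(i < size p) p`_i *
  (GammaR (nu + (1 + alpha + i%:R)) * GammaR (1 + alpha + i%:R) ^+ k.+1).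
have lhsE m n : (\int[lebesgue_measure]_(x in `]0%R, +oo[)
    ((Q n).[x] * (Q m).[x] * rho nu k.+1 x * x `^ alpha)%:E)%E = (L (Q n * Q m))%:E.
  rewrite -(integral_rho_powR_horner _ nu0 a1 (leqnn _)); apply: eq_integral => x _.
  by rewrite hornerM; congr EFin; ring.
have rhsE m n : (\int[lebesgue_measure]_(t in `]0%R, +oo[)
    (rho nu k t * polyop (Q n) (polyop (Q m) (fun u => u `^ alpha)) t)%:E)%E =
    (L (Q n * Q m) / GammaR (1 + alpha))%:E.
  transitivity (\int[lebesgue_measure]_(t in `]0%R, +oo[)
      (rho nu k t * (t `^ alpha * (poly_pochhammer alpha (Q n * Q m)).[t]))%:E)%E.
    apply: eq_integral => t; rewrite inE/= in_itv/= andbT => t0.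
    by rewrite polyop_polyop_powR.
  rewrite (integral_rho_powR_horner _ nu0 a1 (size_poly _ _)); congr EFin.
  rewrite /L mulr_suml; apply: eq_bigr => i _.
  (* One of the [k + 1] factors [GammaR (1 + alpha + i)] splits into the rising factorial, which is
     the coefficient produced by theta, and [GammaR (1 + alpha)], which is the divisor. *)
  rewrite coef_poly_pochhammer exprS GammaR_pochhammer//.
  move: (GammaR (1 + alpha)) (GammaR (nu + _)) G0 => g h g0; by field.
split=> H m n; first by rewrite rhsE; congr EFin; congr (_ / _); apply: EFin_inj; rewrite -lhsE H.
rewrite lhsE; congr EFin; apply: (mulIf (invr_neq0 G0)); apply: EFin_inj; by rewrite -rhsE H.
Qed.
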